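(* Let $k$ be a field, let $A$ be a proper connective dg algebra over $k$ and let $d\ge 1$ be an integer such that $A\in\mathcal{H}^d_A$. Let $b\in\mathbb{N}$ and let $$M_1\xrightarrow{f_1}M_2\xrightarrow{f_2}\cdots\xrightarrow{f_{t-1}}M_t$$ be a sequence of non-isomorphisms in $\mathcal{H}^d_A$ such that every $M_i$ is indecomposable and $\dim_kH^*(M_i)\le b$. If $t\ge (b(d-1)+2)^b$, then $f_{t-1}\circ\cdots\circ f_1=0$.
   Context: A dg algebra $A$ over $k$ (cohomological grading) is connective if $H^i(A)=0$ for $i>0$, and proper if $\bigoplus_i H^i(A)$ is finite-dimensional over $k$. $\mathcal{D}(A)$ is the unbounded derived category of right dg $A$-modules with shift $[1]$, and $\mathcal{D}^{\mathrm{fd}}(A)\subseteq\mathcal{D}(A)$ is the full triangulated subcategory of those $M$ with $H^*(M)=\bigoplus_i H^i(M)$ finite-dimensional over $k$. The extended heart $\mathcal{H}^d_A$ is the full subcategory of $\mathcal{D}^{\mathrm{fd}}(A)$ of objects $M$ with $H^i(M)=0$ unless $-d<i\le 0$. $\dim_kH^*(M)$ denotes the total dimension $\sum_i\dim_kH^i(M)$. *)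

(* Defs.v *)
From HB Require Import structures.
From mathcomp Require Import all_boot all_order all_algebra.

Set Implicit Arguments.
Unset Strict Implicit.
Unset Printing Implicit Defensive.

Import Order.TTheory GRing.Theory Num.Theory.
Local Open Scope ring_scope.

(* Graded operations take the target degree as an argument, together with an
   equation between degrees, so that no axiom needs a transport.  As [int] has
   decidable equality, the operations do not depend on the proof supplied. *)

Record complex (k : fieldType) := Complex {
  cx_obj :> int -> lmodType k;
  dif : forall i j : int, i + 1 = j -> {linear cx_obj i -> cx_obj j};
  dif_dif : forall (i j l : int) (e : i + 1 = j) (e' : j + 1 = l)
    (x : cx_obj i), dif e' (dif e x) = 0 }.

Section Cohomology.
Variables (k : fieldType) (C : complex k).

Definition cocycle (i : int) (x : C i) : Prop := dif C (erefl (i + 1)) x = 0.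

Definition coboundary (i : int) (x : C i) : Prop :=
  exists (j : int) (e : j + 1 = i) (y : C j), x = dif C e y.

Definition coh_zero (i : int) : Prop :=
  forall x : C i, cocycle x -> coboundary x.

(* H^i(C) has dimension n: the classes of z_0, ..., z_(n-1) form a basis. *)
Definition coh_dim (i : int) (n : nat) : Prop :=
  exists z : 'I_n -> C i, (forall p, cocycle (z p)) /\
    (forall x : C i, cocycle x ->
       exists! c : 'rV[k]_n, coboundary (x - \sum_(p < n) c 0 p *: z p)).

(* The sum of the dim H^i(C), over all integers i, is finite and equal to n. *)
Definition coh_total_dim (n : nat) : Prop :=
  exists (s : seq int) (h : int -> nat),
    [/\ uniq s, forall i, i \notin s -> coh_zero i,
        forall i, i \in s -> coh_dim i (h i) & n = (\sum_(i <- s) h i)%N].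

Definition coh_finite : Prop := exists n : nat, coh_total_dim n.

Definition coh_dim_le (b : nat) : Prop :=
  exists n : nat, coh_total_dim n /\ (n <= b)%N.

End Cohomology.

Record dgAlgebra (k : fieldType) := DgAlgebra {
  dga_cx :> complex k;
  dg_one : dga_cx 0;
  dg_mul : forall i j n : int, i + j = n -> dga_cx i -> dga_cx j -> dga_cx n;
  dg_mul_linl : forall (i j n : int) (e : i + j = n) (c : k)
    (x x' : dga_cx i) (y : dga_cx j),
    dg_mul e (c *: x + x') y = c *: dg_mul e x y + dg_mul e x' y;
  dg_mul_linr : forall (i j n : int) (e : i + j = n) (c : k)
    (x : dga_cx i) (y y' : dga_cx j),
    dg_mul e x (c *: y + y') = c *: dg_mul e x y + dg_mul e x y';
  dg_mulA : forall (i j l ij jl n : int) (e1 : i + j = ij) (e2 : ij + l = n)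
    (e3 : j + l = jl) (e4 : i + jl = n)
    (x : dga_cx i) (y : dga_cx j) (z : dga_cx l),
    dg_mul e2 (dg_mul e1 x y) z = dg_mul e4 x (dg_mul e3 y z);
  dg_mul1l : forall (i : int) (e : 0 + i = i) (x : dga_cx i),
    dg_mul e dg_one x = x;
  dg_mul1r : forall (i : int) (e : i + 0 = i) (x : dga_cx i),
    dg_mul e x dg_one = x;
  dg_leibniz : forall (i j n i' j' n' : int) (e : i + j = n)
    (ei : i + 1 = i') (ej : j + 1 = j') (en : n + 1 = n')
    (el : i' + j = n') (er : i + j' = n') (x : dga_cx i) (y : dga_cx j),
    dif _ en (dg_mul e x y) =
      dg_mul el (dif _ ei x) y + ((-1) ^ i : k) *: dg_mul er x (dif _ ej y) }.

Definition dg_connective (k : fieldType) (A : dgAlgebra k) : Prop :=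
  forall i : int, 0 < i -> coh_zero A i.

Definition dg_proper (k : fieldType) (A : dgAlgebra k) : Prop := coh_finite A.

(* Right dg modules. *)
Record dgModule (k : fieldType) (A : dgAlgebra k) := DgModule {
  dgm_cx :> complex k;
  dg_act : forall i j n : int, i + j = n -> dgm_cx i -> A j -> dgm_cx n;
  dg_act_linl : forall (i j n : int) (e : i + j = n) (c : k)
    (x x' : dgm_cx i) (a : A j),
    dg_act e (c *: x + x') a = c *: dg_act e x a + dg_act e x' a;
  dg_act_linr : forall (i j n : int) (e : i + j = n) (c : k)
    (x : dgm_cx i) (a a' : A j),
    dg_act e x (c *: a + a') = c *: dg_act e x a + dg_act e x a';
  dg_actA : forall (i j l ij jl n : int) (e1 : i + j = ij) (e2 : ij + l = n)
    (e3 : j + l = jl) (e4 : i + jl = n) (x : dgm_cx i) (a : A j) (a' : A l),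
    dg_act e2 (dg_act e1 x a) a' = dg_act e4 x (dg_mul e3 a a');
  dg_act1 : forall (i : int) (e : i + 0 = i) (x : dgm_cx i),
    dg_act e x (dg_one A) = x;
  dg_act_leibniz : forall (i j n i' j' n' : int) (e : i + j = n)
    (ei : i + 1 = i') (ej : j + 1 = j') (en : n + 1 = n')
    (el : i' + j = n') (er : i + j' = n') (x : dgm_cx i) (a : A j),
    dif _ en (dg_act e x a) =
      dg_act el (dif _ ei x) a + ((-1) ^ i : k) *: dg_act er x (dif _ ej a) }.

Definition dg_regular (k : fieldType) (A : dgAlgebra k) : dgModule A :=
  DgModule (@dg_mul_linl k A) (@dg_mul_linr k A) (@dg_mulA k A)
    (@dg_mul1r k A) (@dg_leibniz k A).

Section ZeroModule.
Variables (k : fieldType) (A : dgAlgebra k).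

Definition zero_cx : complex k :=
  @Complex k (fun _ => 'rV[k]_0) (fun _ _ _ => \0%R) (fun _ _ _ _ _ _ => erefl).

Definition dg_zero : dgModule A.
Proof.
by apply: (@DgModule k A zero_cx (fun _ _ _ _ _ _ => 0)) => *;
   apply/rowP; case.
Defined.

End ZeroModule.

Section DirectSum.
Variables (k : fieldType) (A : dgAlgebra k) (M N : dgModule A).

Section Dif.
Variables (i j : int) (e : i + 1 = j).

Definition sum_dif (x : M i * N i) : M j * N j := (dif M e x.1, dif N e x.2).

Fact sum_dif_linear : linear sum_dif.
Proof. by move=> c x y; rewrite /sum_dif !linearP. Qed.

HB.instance Definition _ :=
  GRing.isLinear.Build k (M i * N i)%type (M j * N j)%type _ sum_dif
    sum_dif_linear.

End Dif.

Definition sum_cx : complex k.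
Proof.
apply: (@Complex k (fun i => (M i * N i)%type) (fun i j e => sum_dif e)).
by move=> i j l e e' x; rewrite /= /sum_dif /= !dif_dif.
Defined.

Definition sum_act (i j n : int) (e : i + j = n) (x : sum_cx i) (a : A j) :
  sum_cx n := (dg_act e x.1 a, dg_act e x.2 a).

Definition dg_sum : dgModule A.
Proof.
apply: (@DgModule k A sum_cx sum_act).
- by move=> i j n e c x x' a; rewrite /sum_act !dg_act_linl.
- by move=> i j n e c x a a'; rewrite /sum_act !dg_act_linr.
- move=> i j l ij jl n e1 e2 e3 e4 x a a'.
  by rewrite /sum_act /= !(dg_actA e1 e2 e3 e4).
- by move=> i e [x y]; rewrite /sum_act /= !dg_act1.
- move=> i j n i' j' n' e ei ej en el er x a.
  by rewrite /= /sum_dif /= !(dg_act_leibniz e ei ej en el er).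
Defined.

End DirectSum.

Section Morphisms.
Variables (k : fieldType) (A : dgAlgebra k).

Record dgHom (M N : dgModule A) := DgHom {
  dgh_fun :> forall i : int, {linear M i -> N i};
  dgh_dif : forall (i j : int) (e : i + 1 = j) (x : M i),
    dgh_fun j (dif M e x) = dif N e (dgh_fun i x);
  dgh_act : forall (i j n : int) (e : i + j = n) (x : M i) (a : A j),
    dgh_fun n (dg_act e x a) = dg_act e (dgh_fun i x) a }.

Definition dgh_id (M : dgModule A) : dgHom M M :=
  @DgHom M M (fun i => idfun) (fun _ _ _ _ => erefl) (fun _ _ _ _ _ _ => erefl).

Definition dgh_comp (M N P : dgModule A) (g : dgHom N P) (f : dgHom M N) :
  dgHom M P.
Proof.
apply: (@DgHom M P (fun i => g i \o f i)).
- by move=> i j e x; rewrite /= !dgh_dif.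
- by move=> i j n e x a; rewrite /= !dgh_act.
Defined.

Definition dgh_zero (M N : dgModule A) : dgHom M N.
Proof.
apply: (@DgHom M N (fun i => \0%R)).
- by move=> i j e x; rewrite /= linear0.
- move=> i j n e x a /=.
  by have := dg_act_linl e (-1) 0 (0 : N i) a; rewrite !scaleN1r !addNr.
Defined.

Definition quasi_iso (M N : dgModule A) (f : dgHom M N) : Prop :=
  forall i : int,
    (forall x : M i, cocycle x -> coboundary (f i x) -> coboundary x) /\
    (forall y : N i, cocycle y ->
       exists x : M i, cocycle x /\ coboundary (y - f i x)).

(* The derived category D(A) is the localization of the category of right dg
   A-modules at the quasi-isomorphisms: its morphisms are the formal composites
   of dg module maps and of inverses of quasi-isomorphisms, modulo the smallest
   congruence [Deq] for which composition is associative and unital, dg module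
   maps compose as usual, and the formal inverses are inverses.  Maps between
   dg modules that are homotopic are identified by [Deq], since both ends of
   the inclusion into a cylinder are sections of a quasi-isomorphism. *)
Inductive Dhom : dgModule A -> dgModule A -> Type :=
| Dmap (M N : dgModule A) (f : dgHom M N) : Dhom M N
| Dinv (M N : dgModule A) (s : dgHom M N) (qs : quasi_iso s) : Dhom N M
| Dcomp (M N P : dgModule A) (g : Dhom N P) (f : Dhom M N) : Dhom M P.

Definition Did (M : dgModule A) : Dhom M M := Dmap (dgh_id M).
Definition Dzero (M N : dgModule A) : Dhom M N := Dmap (dgh_zero M N).

Inductive Deq : forall M N : dgModule A, Dhom M N -> Dhom M N -> Prop :=
| Deq_refl M N (f : Dhom M N) : Deq f f
| Deq_sym M N (f g : Dhom M N) : Deq f g -> Deq g f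
| Deq_trans M N (f g h : Dhom M N) : Deq f g -> Deq g h -> Deq f h
| Deq_comp M N P (g g' : Dhom N P) (f f' : Dhom M N) :
    Deq g g' -> Deq f f' -> Deq (Dcomp g f) (Dcomp g' f')
| Deq_assoc M N P Q (h : Dhom P Q) (g : Dhom N P) (f : Dhom M N) :
    Deq (Dcomp h (Dcomp g f)) (Dcomp (Dcomp h g) f)
| Deq_idl M N (f : Dhom M N) : Deq (Dcomp (Did N) f) f
| Deq_idr M N (f : Dhom M N) : Deq (Dcomp f (Did M)) f
| Deq_ext M N (f f' : dgHom M N) :
    (forall i, f i =1 f' i) -> Deq (Dmap f) (Dmap f')
| Deq_map M N P (g : dgHom N P) (f : dgHom M N) :
    Deq (Dcomp (Dmap g) (Dmap f)) (Dmap (dgh_comp g f))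
| Deq_invl M N (s : dgHom M N) (qs : quasi_iso s) :
    Deq (Dcomp (Dinv qs) (Dmap s)) (Did M)
| Deq_invr M N (s : dgHom M N) (qs : quasi_iso s) :
    Deq (Dcomp (Dmap s) (Dinv qs)) (Did N).

Definition is_Diso (M N : dgModule A) (f : Dhom M N) : Prop :=
  exists g : Dhom N M, Deq (Dcomp g f) (Did M) /\ Deq (Dcomp f g) (Did N).

Definition Disomorphic (M N : dgModule A) : Prop :=
  exists f : Dhom M N, is_Diso f.

(* Objects of the extended heart H^d_A, a full subcategory of D(A). *)
Definition in_heart (d : nat) (M : dgModule A) : Prop :=
  coh_finite M /\
  forall i : int, ~ (- d%:Z < i /\ i <= 0) -> coh_zero M i.

(* The direct sum of dg modules is the direct sum in D(A). *)
Definition indecomposable (d : nat) (M : dgModule A) : Prop :=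
  ~ Disomorphic M (dg_zero A) /\
  forall X Y : dgModule A, in_heart d X -> in_heart d Y ->
    Disomorphic M (dg_sum X Y) ->
    Disomorphic X (dg_zero A) \/ Disomorphic Y (dg_zero A).

Fixpoint Dcomp_seq (M : nat -> dgModule A)
    (f : forall i : nat, Dhom (M i) (M i.+1)) (n : nat) : Dhom (M 0%N) (M n) :=
  if n is m.+1 then Dcomp (f m) (Dcomp_seq f m) else Did (M 0%N).

End Morphisms.

(* Main.v *)
Require Import Defs.
From HB Require Import structures.
From mathcomp Require Import all_boot all_order all_algebra.
From mathcomp Require Import boolp classical_sets zify.

Set Implicit Arguments.
Unset Strict Implicit.
Unset Printing Implicit Defensive.

Import Order.TTheory GRing.Theory Num.Theory.
Local Open Scope ring_scope.

(** As for the Harada-Sai lemma, let the rank of a morphism be the rank of the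
    map it induces on total cohomology; by induction on j, a composite of
    sufficiently many non-isomorphisms has rank <= b - j.  A non-isomorphism has
    rank <= b - 1.  Suppose that composites of n non-isomorphisms have rank <= r,
    and that a composite of 2d such blocks and of the 2d - 1 non-isomorphisms
    connecting them has rank exactly r > 0.  Every morphism W -> V of D(A) and
    every degree i give a factorization W -> V' -> V in which V' has the
    cohomology of V below i, that of W above i, and the image in degree i.  One
    such factorization per block, from degree 1 - d to degree 0, yields objects Z
    and Z' through which the first and the last d blocks factor, with
    H(Z) -> H(Y) injective and H(X) -> H(Z') surjective, where h : Y -> X is the
    connecting morphism in the middle.  Then Z -> Y -> X -> Z' is an isomorphism,
    so Z is a direct summand of Y and of X; by indecomposability h is an
    isomorphism, a contradiction.  Hence 2 (2d)^(b-1) objects force rank 0, and a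
    composite of d morphisms of rank 0 vanishes: by the same factorization a
    composite of e of them factors through an object concentrated in degrees
    <= -e.

    As A need not vanish in positive degrees, dg modules have no naive
    truncations.  The factorization is instead the limit of a tower of homotopy
    fibres of maps to coinduced modules Hom_k(A, U), each of which kills the
    lowest cohomology of the cone of W -> V in degrees >= i. *)

(** * Linear algebra *)

Section Subspaces.
Variables (k : fieldType) (V : lmodType k).
Implicit Types P Q : V -> Prop.

Definition subspace P : Prop :=
  P 0 /\ forall (a : k) x y, P x -> P y -> P (a *: x + y).

Lemma subspaceD P x y : subspace P -> P x -> P y -> P (x + y).
Proof. by move=> [_ h] px py; rewrite -[x]scale1r; apply: h. Qed.

Lemma subspaceZ P a x : subspace P -> P x -> P (a *: x).
Proof. by move=> [h0 h] px; rewrite -[a *: x]addr0; apply: h. Qed.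

Lemma subspaceN P x : subspace P -> P x -> P (- x).
Proof. by move=> sP px; rewrite -scaleN1r; apply: subspaceZ. Qed.

Lemma subspaceB P x y : subspace P -> P x -> P y -> P (x - y).
Proof. by move=> sP px py; apply: subspaceD => //; apply: subspaceN. Qed.

(** By Zorn's lemma there is a maximal subspace meeting [P] in 0 only; a vector outside its sum with
    [P] could be adjoined to it. *)
Lemma exists_complement P : subspace P ->
  exists Q, [/\ subspace Q, forall x, P x -> Q x -> x = 0
              & forall x, exists2 y, P y & Q (x - y)].
Proof.
move=> sP.
pose good (Q : set V) := subspace Q /\ forall x, P x -> Q x -> x = 0.
pose X := {Q : set V | good Q}.
pose R (C D : X) := `[< forall x, sval C x -> sval D x >].
have good0 : good (fun x => x = 0).
  split; last by move=> x _ ->.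
  by split=> // a x y -> ->; rewrite scaler0 addr0.
have [|||F totF|[Q gQ] Qmax] := @Zorn X R.
- by move=> C; apply/asboolP.
- move=> C D E /asboolP h1 /asboolP h2; apply/asboolP => x /h1; exact: h2.
- move=> [C gC] [D gD] /asboolP /= h1 /asboolP /= h2.
  apply: eq_exist; apply/funext => x; apply/propext; split; [exact: h1|exact: h2].
- have gU : good (fun x => x = 0 \/ exists2 C, F C & sval C x).
    split; last first.
      move=> x Px [//|[[C [sC PC]] _ /=]]; exact: PC.
    split; first by left.
    move=> a x y [->|[C FC Cx]] [->|[D FD Dy]].
    + by left; rewrite scaler0 addr0.
    + by right; exists D => //; rewrite scaler0 add0r.
    + right; exists C => //; rewrite addr0; apply: subspaceZ => //.
      by case: (svalP C).
    + have [/asboolP CD|/asboolP DC] := totF _ _ FC FD; right.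
      * exists D => //; have [[_ h] _] := svalP D; apply: h => //; exact: CD.
      * exists C => //; have [[_ h] _] := svalP C; apply: h => //; exact: DC.
  exists (exist _ _ gU) => C FC; apply/asboolP => x Cx /=; right; by exists C.
have [sQ PQ] := gQ.
exists Q; split=> // x; apply: contrapT => nx.
(* The span of [Q] and [x]. It still meets [P] trivially, because a multiple of [x] lying in P + Q
   would put [x] there. *)
pose Q' y := exists (a : k), Q (y - a *: x).
have Q'P y : P y -> Q' y -> y = 0.
  move=> Py [a Qa]; have [a0|a0] := eqVneq a 0.
    by apply: PQ => //; move: Qa; rewrite a0 scale0r subr0.
  case: nx; exists (a^-1 *: y); first exact: subspaceZ.
  have -> : x - a^-1 *: y = - a^-1 *: (y - a *: x).
    by rewrite scalerBr scalerA !scaleNr mulNr mulVf // scaleN1r opprK addrC.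
  exact: subspaceZ.
have sQ' : subspace Q'.
  split; first by exists 0; rewrite scale0r subr0; case: sQ.
  move=> a y z [c Qc] [e Qe]; exists (a * c + e).
  have -> : a *: y + z - (a * c + e) *: x
      = a *: (y - c *: x) + (z - e *: x).
    by rewrite scalerBr scalerDl scalerA opprD addrACA.
  by case: sQ => _; apply.
have gQ' : good Q' by [].
have RQ : R (exist _ Q gQ) (exist _ Q' gQ').
  by apply/asboolP => y /= Qy; exists 0; rewrite scale0r subr0.
have QQ' : Q' = Q by have := congr1 sval (Qmax _ RQ).
apply: nx; exists 0; first by case: sP.
rewrite subr0 -QQ'.
by exists 1; rewrite scale1r subrr; case: sQ.
Qed.

End Subspaces.

(** Choose complements C of the kernel and D of the image. Then [s] projects along D onto the image
    and takes the preimage in C. *)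
Lemma linear_pseudo_inverse (k : fieldType) (X Y : lmodType k)
    (u : {linear X -> Y}) :
  exists s : {linear Y -> X}, forall x, u (s (u x)) = u x.
Proof.
have sker : subspace (fun x => u x = 0).
  by split=> [|a x y ux uy]; rewrite ?linear0 // linearP ux uy scaler0 addr0.
have sim : subspace (fun y => exists x, y = u x).
  split; first by exists 0; rewrite linear0.
  by move=> a _ _ [x ->] [x' ->]; exists (a *: x + x'); rewrite linearP.
have [C [sC kerC addC]] := exists_complement sker.
have [D [sD imD addD]] := exists_complement sim.
have ex y : exists x, C x /\ D (y - u x).
  have [_ [x ->] Dx] := addD y; have [z uz Cz] := addC x.
  by exists (x - z); split=> //; rewrite linearB uz subr0.
have uniq_s y x x' : C x -> D (y - u x) -> C x' -> D (y - u x') -> x = x'.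
  move=> Cx Dx Cx' Dx'; apply/eqP; rewrite -subr_eq0; apply/eqP.
  apply: kerC; last exact: subspaceB.
  rewrite linearB; apply: imD; first by exists (x - x'); rewrite linearB.
  have -> : u x - u x' = (y - u x') - (y - u x).
    by rewrite opprB [RHS]addrC addrA subrK.
  exact: subspaceB.
have [s sP] := choice ex.
have slin : linear s.
  move=> a y z; have [Cy Dy] := sP y; have [Cz Dz] := sP z.
  have [Cyz Dyz] := sP (a *: y + z).
  apply: (uniq_s (a *: y + z)) => //; first by case: sC => _; apply.
  rewrite linearP opprD addrACA -scalerN -scalerDr.
  by case: sD => _; apply.
pose s' := GRing.isLinear.Build k Y X _ s slin.
pose s'' : {linear Y -> X} := HB.pack s s'.
exists s'' => x /=; have [_ Dx] := sP (u x).
apply/esym/eqP; rewrite -subr_eq0; apply/eqP/imD => //.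
by exists (x - s (u x)); rewrite linearB.
Qed.

(** With [s] a pseudo-inverse of [u], the map [w] is [v] after [s]: the vector x - s (u x) lies in
    the kernel of [u], hence in that of [v]. *)
Lemma linear_factor (k : fieldType) (X Y Z : lmodType k) (u : {linear X -> Y})
    (v : {linear X -> Z}) :
  (forall x, u x = 0 -> v x = 0) ->
  exists w : {linear Y -> Z}, forall x, v x = w (u x).
Proof.
move=> h; have [s us] := linear_pseudo_inverse u.
exists (v \o s) => x /=; apply/eqP; rewrite -subr_eq0 -linearB; apply/eqP/h.
by rewrite linearB us subrr.
Qed.

(** * Subspaces of products of vector spaces *)

Section SubProduct.
Variables (k : fieldType) (I : Type) (V : I -> lmodType k).

Definition fam_closed (P : (forall i, V i) -> Prop) : Prop :=
  P (fun=> 0) /\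
  forall (a : k) f g, P f -> P g -> P (fun i => a *: f i + g i).

Variables (P : (forall i, V i) -> Prop) (hP : fam_closed P).

(** The closure proof is a parameter of the type, so that the module structure can be attached to
    the type. It serves twice: for spaces of linear maps on [A], and for inverse limits. *)
Record subprod_of (hP : fam_closed P) :=
  SubProd { sp_fun :> forall i, V i; sp_prop : P sp_fun }.

Local Notation T := (subprod_of hP).

HB.instance Definition _ := gen_eqMixin T.
HB.instance Definition _ := gen_choiceMixin T.

Lemma sp_ext (f g : T) : (forall i, f i = g i) -> f = g.
Proof.
case: f g => [f Pf] [g Pg] /= fg.
have {}fg : f = g by apply: functional_extensionality_dep.
by subst g; congr SubProd; apply: Prop_irrelevance.
Qed.

Fact sp_lin_prop (a : k) (f g : T) : P (fun i => a *: f i + g i).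
Proof. by have [_ h] := hP; apply: h; apply: sp_prop. Qed.

Fact sp_add_prop (f g : T) : P (fun i => f i + g i).
Proof.
have -> : (fun i => f i + g i) = (fun i => 1 *: f i + g i).
  by apply: functional_extensionality_dep => i; rewrite scale1r.
exact: sp_lin_prop.
Qed.

Fact sp_opp_prop (f : T) : P (fun i => - f i).
Proof.
have -> : (fun i => - f i) = (fun i => -1 *: f i + 0).
  by apply: functional_extensionality_dep => i; rewrite scaleN1r addr0.
by have [h0 h] := hP; apply: h => //; apply: sp_prop.
Qed.

Fact sp_scale_prop (a : k) (f : T) : P (fun i => a *: f i).
Proof.
have -> : (fun i => a *: f i) = (fun i => a *: f i + 0).
  by apply: functional_extensionality_dep => i; rewrite addr0.
by have [h0 h] := hP; apply: h => //; apply: sp_prop.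
Qed.

Definition sp_zero : T := SubProd hP (proj1 hP).
Definition sp_add (f g : T) : T := SubProd hP (sp_add_prop f g).
Definition sp_opp (f : T) : T := SubProd hP (sp_opp_prop f).
Definition sp_scale (a : k) (f : T) : T := SubProd hP (sp_scale_prop a f).

Fact sp_addA : associative sp_add.
Proof. by move=> f g h; apply: sp_ext => i /=; rewrite addrA. Qed.
Fact sp_addC : commutative sp_add.
Proof. by move=> f g; apply: sp_ext => i /=; rewrite addrC. Qed.
Fact sp_add0 : left_id sp_zero sp_add.
Proof. by move=> f; apply: sp_ext => i /=; rewrite add0r. Qed.
Fact sp_addN : left_inverse sp_zero sp_opp sp_add.
Proof. by move=> f; apply: sp_ext => i /=; rewrite addNr. Qed.

HB.instance Definition _ :=
  GRing.isZmodule.Build T sp_addA sp_addC sp_add0 sp_addN.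

Fact sp_scaleA a b f : sp_scale a (sp_scale b f) = sp_scale (a * b) f.
Proof. by apply: sp_ext => i /=; rewrite scalerA. Qed.
Fact sp_scale1 : left_id 1 sp_scale.
Proof. by move=> f; apply: sp_ext => i /=; rewrite scale1r. Qed.
Fact sp_scaleDr : right_distributive sp_scale +%R.
Proof. by move=> a f g; apply: sp_ext => i /=; rewrite scalerDr. Qed.
Fact sp_scaleDl f : {morph sp_scale^~ f : a b / a + b}.
Proof. by move=> a b; apply: sp_ext => i /=; rewrite scalerDl. Qed.

HB.instance Definition _ := GRing.Zmodule_isLmodule.Build k T
  sp_scaleA sp_scale1 sp_scaleDr sp_scaleDl.

End SubProduct.

(** * Complexes and homotopy fibres *)

Section Complexes.
Variables (k : fieldType) (C : complex k).

(* Transport along an equality of degrees. *)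
Definition cs (i j : int) (e : i = j) : {linear C i -> C j} :=
  match e in _ = j return {linear C i -> C j} with erefl => idfun end.

Lemma csE i (e : i = i) x : cs e x = x.
Proof. by rewrite (eq_irrelevance e erefl). Qed.

Lemma cs_inj i j (e : i = j) x y : cs e x = cs e y -> x = y.
Proof. by subst; rewrite !csE. Qed.

Lemma dif_irr i j (e e' : i + 1 = j) x : dif C e x = dif C e' x.
Proof. by rewrite (eq_irrelevance e e'). Qed.

Lemma dif_cs i j l (e : i = j) (e1 : j + 1 = l) (e2 : i + 1 = l) x :
  dif C e1 (cs e x) = dif C e2 x.
Proof. by subst; rewrite csE; apply: dif_irr. Qed.

Lemma cs_dif i j l (e1 : i + 1 = j) (e : j = l) (e2 : i + 1 = l) x :
  cs e (dif C e1 x) = dif C e2 x.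
Proof. by subst; rewrite csE; apply: dif_irr. Qed.

Lemma cocycleP i j (e : i + 1 = j) (x : C i) : cocycle x <-> dif C e x = 0.
Proof. by subst. Qed.

Lemma cocycle0 i : cocycle (0 : C i).
Proof. by rewrite /cocycle linear0. Qed.

Lemma cocycleD i (x y : C i) : cocycle x -> cocycle y -> cocycle (x + y).
Proof. by rewrite /cocycle linearD => -> ->; rewrite addr0. Qed.

Lemma cocycleZ a i (x : C i) : cocycle x -> cocycle (a *: x).
Proof. by rewrite /cocycle linearZ /= => ->; rewrite scaler0. Qed.

Lemma cocycleN i (x : C i) : cocycle x -> cocycle (- x).
Proof. by rewrite /cocycle linearN => ->; rewrite oppr0. Qed.

Lemma cocycleB i (x y : C i) : cocycle x -> cocycle y -> cocycle (x - y).
Proof. by move=> hx hy; apply/cocycleD/cocycleN. Qed.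

Lemma coboundary0 i : coboundary (0 : C i).
Proof. by exists (i - 1), (subrK 1 i), 0; rewrite linear0. Qed.

Lemma coboundaryD i (x y : C i) :
  coboundary x -> coboundary y -> coboundary (x + y).
Proof.
move=> [j [e [u ->]]] [l [e' [v ->]]].
have ejl : l = j by lia.
subst l; exists j, e, (u + v); rewrite linearD; congr (_ + _); exact: dif_irr.
Qed.

Lemma coboundaryZ a i (x : C i) : coboundary x -> coboundary (a *: x).
Proof. by move=> [j [e [u ->]]]; exists j, e, (a *: u); rewrite linearZ. Qed.

Lemma coboundaryN i (x : C i) : coboundary x -> coboundary (- x).
Proof. by rewrite -scaleN1r; apply: coboundaryZ. Qed.

Lemma coboundaryB i (x y : C i) :
  coboundary x -> coboundary y -> coboundary (x - y).
Proof. by move=> hx hy; apply/coboundaryD/coboundaryN. Qed.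

Lemma coboundaryP i j (e : j + 1 = i) (x : C i) :
  coboundary x <-> exists y, x = dif C e y.
Proof.
split=> [[l [e' [y ->]]]|[y ->]]; last by exists j, e, y.
have ejl : l = j by lia.
by subst l; exists y; apply: dif_irr.
Qed.

Lemma coboundary_dif i j (e : j + 1 = i) (y : C j) : coboundary (dif C e y).
Proof. by exists j, e, y. Qed.

Lemma cocycle_dif i j (e : j + 1 = i) (y : C j) : cocycle (dif C e y).
Proof. exact: dif_dif. Qed.

Lemma coboundary_cocycle i (x : C i) : coboundary x -> cocycle x.
Proof. by move=> [j [e [y ->]]]; apply: cocycle_dif. Qed.

Lemma coboundaryC i (x y : C i) : coboundary (x - y) -> coboundary (y - x).
Proof. by rewrite -(opprB x); apply: coboundaryN. Qed.

Lemma coboundary_trans i (x y z : C i) :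
  coboundary (x - y) -> coboundary (y - z) -> coboundary (x - z).
Proof. by move=> h1 h2; rewrite -(subrKA y); apply: coboundaryD. Qed.

End Complexes.

Section Degrees.
Variables (k : fieldType) (A : dgAlgebra k) (M : dgModule A).

Lemma act_irr i j n (e e' : i + j = n) (x : M i) (a : A j) :
  dg_act e x a = dg_act e' x a.
Proof. by rewrite (eq_irrelevance e e'). Qed.

Lemma act_cs i i' j n (e : i = i') (e1 : i' + j = n) (e2 : i + j = n)
  (x : M i) (a : A j) : dg_act e1 (cs M e x) a = dg_act e2 x a.
Proof. by subst; rewrite csE; apply: act_irr. Qed.

Lemma act_csr i j j' n (e : j = j') (e1 : i + j' = n) (e2 : i + j = n)
  (x : M i) (a : A j) : dg_act e1 x (cs A e a) = dg_act e2 x a.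
Proof. by subst; rewrite csE; apply: act_irr. Qed.

Lemma cs_act i j n n' (e1 : i + j = n) (e : n = n') (e2 : i + j = n')
  (x : M i) (a : A j) : cs M e (dg_act e1 x a) = dg_act e2 x a.
Proof. by subst; rewrite csE; apply: act_irr. Qed.

Lemma actDl i j n (e : i + j = n) (x y : M i) (a : A j) :
  dg_act e (x + y) a = dg_act e x a + dg_act e y a.
Proof. by have := dg_act_linl e 1 x y a; rewrite !scale1r. Qed.

Lemma act0l i j n (e : i + j = n) (a : A j) : dg_act e (0 : M i) a = 0.
Proof.
by have := dg_act_linl e (-1) 0 (0 : M i) a; rewrite !scaleN1r !addNr.
Qed.

Lemma actZl c i j n (e : i + j = n) (x : M i) (a : A j) :
  dg_act e (c *: x) a = c *: dg_act e x a.
Proof. by have := dg_act_linl e c x 0 a; rewrite act0l !addr0. Qed.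

Lemma actNl i j n (e : i + j = n) (x : M i) (a : A j) :
  dg_act e (- x) a = - dg_act e x a.
Proof. by rewrite -scaleN1r actZl scaleN1r. Qed.

Lemma actBl i j n (e : i + j = n) (x y : M i) (a : A j) :
  dg_act e (x - y) a = dg_act e x a - dg_act e y a.
Proof. by rewrite actDl actNl. Qed.

End Degrees.

Lemma hom_cs (k : fieldType) (A : dgAlgebra k) (M N : dgModule A)
    (f : dgHom M N) i j (e : i = j) x : f j (cs M e x) = cs N e (f i x).
Proof. by subst; rewrite !csE. Qed.

Section SignLemmas.
Variable k : fieldType.

Lemma sgnS (i : int) : (-1 : k) ^ (i + 1) = - (-1) ^ i.
Proof. by rewrite expfzDr ?oppr_eq0 ?oner_neq0 // expr1z mulrN1. Qed.

Lemma sgnP (i : int) : (-1 : k) ^ (i - 1) = - (-1) ^ i.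
Proof. by rewrite -[in RHS](subrK 1 i) sgnS opprK. Qed.

End SignLemmas.

Section Fiber.
Variables (k : fieldType) (A : dgAlgebra k) (X N : dgModule A).
Variable psi : dgHom X N.

Fact fib_eq (i j : int) (e : i + 1 = j) : i = j - 1.
Proof. by lia. Qed.

Fact fib_eq1 (i j : int) (e : i + 1 = j) : i - 1 + 1 = j - 1.
Proof. by lia. Qed.

Fact fib_eqA (i j n : int) (e : i + j = n) : i - 1 + j = n - 1.
Proof. by lia. Qed.

(** The shifted cone X + N[-1]: a cocycle is a cocycle x of [X] together with y such that dy =
    psi(x). With this sign on d of [N], the right action of [A] needs no sign. *)
Definition fib_dif (i j : int) (e : i + 1 = j) (x : X i * N (i - 1)) : X j * N (j - 1) :=
  (dif X e x.1, cs N (fib_eq e) (psi i x.1) - dif N (fib_eq1 e) x.2).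

Fact fib_dif_linear i j (e : i + 1 = j) : linear (@fib_dif i j e).
Proof.
move=> c x y; rewrite /fib_dif !linearP /=; congr (_, _).
set u := cs _ _ _; set v := cs _ _ _; set p := dif _ _ _; set q := dif _ _ _.
change (c *: u + v + (c *: - p - q) = c *: (u - p) + (v - q)).
by rewrite scalerBr scalerN addrACA.
Qed.

HB.instance Definition _ i j (e : i + 1 = j) :=
  GRing.isLinear.Build k (X i * N (i - 1))%type (X j * N (j - 1))%type _
    (fib_dif e) (fib_dif_linear e).

Definition fib_cx : complex k.
Proof.
apply: (@Complex k (fun i => (X i * N (i - 1))%type) (fun i j e => fib_dif e)).
move=> i j l e e' x; rewrite /= /fib_dif /= dif_dif; congr (_, _).
rewrite dgh_dif linearB /= dif_dif subr0.
have e2 : i + 1 = l - 1 by lia.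
by rewrite (cs_dif _ _ e2) (dif_cs _ _ e2) subrr.
Defined.

Definition fib_act i j n (e : i + j = n) (x : fib_cx i) (a : A j) : fib_cx n :=
  (dg_act e x.1 a, dg_act (fib_eqA e) x.2 a).

Definition dg_fib : dgModule A.
Proof.
apply: (@DgModule k A fib_cx fib_act).
- by move=> i j n e c x x' a; rewrite /fib_act !dg_act_linl.
- by move=> i j n e c x a a'; rewrite /fib_act !dg_act_linr.
- move=> i j l ij jl n e1 e2 e3 e4 x a a'; rewrite /fib_act /=.
  rewrite (dg_actA e1 e2 e3 e4).
  by rewrite (dg_actA (fib_eqA e1) (fib_eqA e2) e3 (fib_eqA e4)).
- by move=> i e [x y]; rewrite /fib_act /= !dg_act1.
- move=> i j n i' j' n' e ei ej en el er x a.
  rewrite /= /fib_dif /fib_act /= (dg_act_leibniz e ei ej en el er).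
  congr (_, _); rewrite actBl dgh_act /=.
  rewrite (cs_act _ _ (etrans (congr1 (+%R^~ j) (fib_eq ei)) (fib_eqA el))).
  rewrite (act_cs _ _ (etrans (congr1 (+%R^~ j) (fib_eq ei)) (fib_eqA el))).
  rewrite (dg_act_leibniz (fib_eqA e) (fib_eq1 ei) ej (fib_eq1 en)
    (fib_eqA el) (fib_eqA er)).
  by rewrite sgnP scaleNr opprB addrA addrAC.
Defined.

Lemma fib_difE i j (e : i + 1 = j) (x : dg_fib i) :
  dif dg_fib e x =
    (dif X e x.1, cs N (fib_eq e) (psi i x.1) - dif N (fib_eq1 e) x.2).
Proof. by []. Qed.

Lemma sum_difE i j (e : i + 1 = j) (x : dg_sum X N i) :
  dif (dg_sum X N) e x = (dif X e x.1, dif N e x.2).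
Proof. by []. Qed.

Definition fib_proj : dgHom dg_fib X.
Proof. by apply: (@DgHom k A dg_fib X (fun i => fst)). Defined.

Definition fib_snd i : {linear dg_fib i -> N (i - 1)} := snd.

End Fiber.

Section FiberLift.
Variables (k : fieldType) (A : dgAlgebra k) (W X N : dgModule A).
Variables (psi : dgHom X N) (f : dgHom W X).
Variable h : forall i : int, {linear W i -> N (i - 1)}.
Hypothesis h_dif : forall i j (e : i + 1 = j) (w : W i),
  h j (dif W e w) = cs N (fib_eq e) (psi i (f i w)) - dif N (fib_eq1 e) (h i w).
Hypothesis h_act : forall i j n (e : i + j = n) (w : W i) (a : A j),
  h n (dg_act e w a) = dg_act (fib_eqA e) (h i w) a.

Definition fib_lift_fun i (w : W i) : dg_fib psi i := (f i w, h i w).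

Fact fib_lift_linear i : linear (@fib_lift_fun i).
Proof. by move=> c x y; rewrite /fib_lift_fun !linearP. Qed.

HB.instance Definition _ i := GRing.isLinear.Build k (W i) (dg_fib psi i) _
  (@fib_lift_fun i) (@fib_lift_linear i).

(** The universal property of the homotopy fibre: [h] is an [A]-linear null-homotopy of [psi] after
    [f]. *)
Definition fib_lift : dgHom W (dg_fib psi).
Proof.
apply: (@DgHom k A W (dg_fib psi) (fun i => @fib_lift_fun i)).
- by move=> i j e x; rewrite /= /fib_lift_fun /fib_dif /= h_dif dgh_dif.
- by move=> i j n e x a; rewrite /= /fib_lift_fun /fib_act /= h_act dgh_act.
Defined.

End FiberLift.

Section HomOperations.
Variables (k : fieldType) (A : dgAlgebra k) (M N P : dgModule A).

Definition dgh_fst : dgHom (dg_sum M N) M.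
Proof. by apply: (@DgHom k A (dg_sum M N) M (fun i => fst)). Defined.

Definition dgh_snd : dgHom (dg_sum M N) N.
Proof. by apply: (@DgHom k A (dg_sum M N) N (fun i => snd)). Defined.

Section Pair.
Variables (f : dgHom P M) (g : dgHom P N).

Definition pair_fun i (x : P i) : dg_sum M N i := (f i x, g i x).

Fact pair_fun_linear i : linear (@pair_fun i).
Proof. by move=> c x y; rewrite /pair_fun !linearP. Qed.

HB.instance Definition _ i := GRing.isLinear.Build k (P i) (dg_sum M N i) _
  (@pair_fun i) (@pair_fun_linear i).

Definition dgh_pair : dgHom P (dg_sum M N).
Proof.
apply: (@DgHom k A P (dg_sum M N) (fun i => @pair_fun i)).
- by move=> i j e x; rewrite /= /pair_fun /sum_dif !dgh_dif.
- by move=> i j n e x a; rewrite /= /pair_fun /sum_act !dgh_act.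
Defined.

End Pair.

Section Sub.
Variables (f g : dgHom M N).

Definition sub_fun i (x : M i) : N i := f i x - g i x.

Fact sub_fun_linear i : linear (@sub_fun i).
Proof.
by move=> c x y; rewrite /sub_fun !linearP /= scalerDr addrACA.
Qed.

HB.instance Definition _ i := GRing.isLinear.Build k (M i) (N i) _
  (@sub_fun i) (@sub_fun_linear i).

Definition dgh_sub : dgHom M N.
Proof.
apply: (@DgHom k A M N (fun i => @sub_fun i)).
- by move=> i j e x; rewrite /= /sub_fun !dgh_dif linearB.
- by move=> i j n e x a; rewrite /= /sub_fun !dgh_act actBl.
Defined.

End Sub.
End HomOperations.

(** * The derived category *)

Section Localization.
Variables (k : fieldType) (A : dgAlgebra k).
Implicit Types M N P : dgModule A.

Lemma dgh_cocycle M N (f : dgHom M N) i (x : M i) : cocycle x -> cocycle (f i x).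
Proof. by rewrite /cocycle -dgh_dif => ->; rewrite linear0. Qed.

Lemma dgh_coboundary M N (f : dgHom M N) i (x : M i) :
  coboundary x -> coboundary (f i x).
Proof. by move=> [j [e [y ->]]]; rewrite dgh_dif; apply: coboundary_dif. Qed.

Lemma quasi_iso_id M : quasi_iso (dgh_id M).
Proof.
move=> i; split=> // y cy; exists y; split=> //=.
by rewrite subrr; apply: coboundary0.
Qed.

Lemma quasi_iso_comp M N P (g : dgHom N P) (f : dgHom M N) :
  quasi_iso g -> quasi_iso f -> quasi_iso (dgh_comp g f).
Proof.
move=> qg qf i; have [gi gs] := qg i; have [fi fs] := qf i; split=> [x cx|z cz].
  by move/gi => h; apply/fi/h => //; apply: dgh_cocycle.
have [y [cy hy]] := gs _ cz; have [x [cx hx]] := fs _ cy.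
exists x; split=> //=; apply: coboundary_trans hy _.
by rewrite -linearB; apply: dgh_coboundary.
Qed.

Lemma Deq_compl M N P (g : Dhom N P) (f f' : Dhom M N) :
  Deq f f' -> Deq (Dcomp g f) (Dcomp g f').
Proof. by move=> h; apply: Deq_comp => //; apply: Deq_refl. Qed.

Lemma Deq_compr M N P (g g' : Dhom N P) (f : Dhom M N) :
  Deq g g' -> Deq (Dcomp g f) (Dcomp g' f).
Proof. by move=> h; apply: Deq_comp => //; apply: Deq_refl. Qed.

Lemma Deq_cancelr M N P (f g : Dhom N P) (u : Dhom M N) :
  is_Diso u -> Deq (Dcomp f u) (Dcomp g u) -> Deq f g.
Proof.
move=> [v [_ uv]] h.
have aux (w : Dhom N P) : Deq w (Dcomp (Dcomp w u) v).
  apply: Deq_trans (Deq_assoc _ _ _).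
  apply: Deq_trans (Deq_compl w (Deq_sym uv)); exact/Deq_sym/Deq_idr.
apply: Deq_trans (aux f) _; apply: Deq_trans (Deq_sym (aux g)).
exact: Deq_compr.
Qed.

Lemma Diso_qis M N (s : dgHom M N) : quasi_iso s -> is_Diso (Dmap s).
Proof. by move=> qs; exists (Dinv qs); split; [exact: Deq_invl|exact: Deq_invr]. Qed.

Lemma Diso_inv M N (s : dgHom M N) (qs : quasi_iso s) : is_Diso (Dinv qs).
Proof. by exists (Dmap s); split; [exact: Deq_invr|exact: Deq_invl]. Qed.

Lemma Diso_comp M N P (g : Dhom N P) (f : Dhom M N) :
  is_Diso g -> is_Diso f -> is_Diso (Dcomp g f).
Proof.
move=> [g' [g1 g2]] [f' [f1 f2]]; exists (Dcomp f' g'); split.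
- apply: Deq_trans (Deq_assoc _ _ _) _.
  apply: Deq_trans _ f1; apply: Deq_compr.
  apply: Deq_trans (Deq_sym (Deq_assoc _ _ _)) _.
  by apply: Deq_trans (Deq_idr _); apply: Deq_compl.
- apply: Deq_trans (Deq_assoc _ _ _) _.
  apply: Deq_trans _ g2; apply: Deq_compr.
  apply: Deq_trans (Deq_sym (Deq_assoc _ _ _)) _.
  by apply: Deq_trans (Deq_idr _); apply: Deq_compl.
Qed.

(* The homotopy fibre of N + N -> N, (x, y) |-> x - y, is a path object of N. *)
Definition path_diff N := dgh_sub (dgh_fst N N) (dgh_snd N N).
Definition path_obj N := dg_fib (path_diff N).

Definition path_const N : dgHom N (path_obj N).
Proof.
apply: (@fib_lift _ _ _ _ _ (path_diff N) (dgh_pair (dgh_id N) (dgh_id N))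
  (fun i => \0%R)).
- by move=> i j e w; rewrite /= /sub_fun /= subrr !linear0 addr0.
- by move=> i j n e w a; rewrite /= act0l.
Defined.

Lemma path_const_qis N : quasi_iso (path_const N).
Proof.
move=> i; split=> [x cx|[[a b] y]].
  by move=> [j [e [[[a b] y] [-> _ _]]]]; apply: coboundary_dif.
rewrite /cocycle => -[da db /=]; rewrite /sub_fun /= => hy.
exists b; split=> //; apply/(coboundaryP (subrK 1 i)).
(* As dy = a - b, the differential of this element is the difference of ((a, b), y) and the constant
   path at b. *)
exists ((y, 0), 0) => /=.
rewrite /fib_dif /= /sum_dif /fib_lift_fun /= /pair_fun /sub_fun /=.
rewrite !linear0 !addr0 csE ?subr0.
move/eqP: hy; rewrite subr_eq0 => /eqP hy.
have -> : dif N (subrK 1 i) y = a - b.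
  apply: (@cs_inj _ _ _ _ (fib_eq (erefl (i + 1)))); rewrite hy.
  by rewrite (cs_dif _ _ (fib_eq1 (erefl (i + 1)))).
congr (_, _, _); by rewrite /= ?subrr ?subr0.
Qed.

(** Both ends become the identity after composition with the constant path, which is invertible in
    D(A). *)
Lemma Deq_path_ends N :
  Deq (Dmap (dgh_comp (dgh_fst N N) (fib_proj (path_diff N))))
      (Dmap (dgh_comp (dgh_snd N N) (fib_proj (path_diff N)))).
Proof.
apply: (Deq_cancelr (Diso_qis (@path_const_qis N))).
apply: Deq_trans (Deq_map _ _) _; apply: Deq_trans (Deq_sym (Deq_map _ _)).
by apply: Deq_ext => i x; cbn.
Qed.

(** A homotopy is a map to the path object with ends [f] and [g]. *)
Lemma Deq_homotopy M N (f g : dgHom M N)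
    (h : forall i : int, {linear M i -> N (i - 1)}) :
  (forall i j (e : i + 1 = j) x, h j (dif M e x) =
     cs N (fib_eq e) (f i x - g i x) - dif N (fib_eq1 e) (h i x)) ->
  (forall i j n (e : i + j = n) x (a : A j),
     h n (dg_act e x a) = dg_act (fib_eqA e) (h i x) a) ->
  Deq (Dmap f) (Dmap g).
Proof.
move=> hd ha.
pose l := @fib_lift _ _ _ _ _ (path_diff N) (dgh_pair f g) h hd ha.
apply: Deq_trans (_ : Deq _ (Dcomp (Dmap (dgh_comp (dgh_fst N N)
  (fib_proj (path_diff N)))) (Dmap l))) _.
  by apply: Deq_trans _ (Deq_sym (Deq_map _ _)); apply: Deq_ext.
apply: Deq_trans (Deq_compr _ (Deq_path_ends N)) _.
by apply: Deq_trans (Deq_map _ _) _; apply: Deq_ext.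
Qed.

End Localization.

(** * Morphisms of the derived category as roofs *)

Section Roofs.
Variables (k : fieldType) (A : dgAlgebra k).
Implicit Types M N P : dgModule A.

(** The fibre of g - s on M + M' is the homotopy pullback; its last component is a homotopy between
    the two composites. *)
Lemma Deq_fib_square M M' N (g : dgHom M N) (s : dgHom M' N)
    (psi := dgh_sub (dgh_comp g (dgh_fst M M')) (dgh_comp s (dgh_snd M M')))
    (p := dgh_comp (dgh_fst M M') (fib_proj psi))
    (q := dgh_comp (dgh_snd M M') (fib_proj psi)) :
  Deq (Dmap (dgh_comp g p)) (Dmap (dgh_comp s q)).
Proof.
apply: (@Deq_homotopy _ _ _ _ _ _ (fib_snd psi)) => [i j e [[m m'] y]|i j n e [[m m'] y] a]; cbn.
  by rewrite /sub_fun /=.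
by [].
Qed.

(** With the preceding square this is the Ore condition: homotopy pullback preserves
    quasi-isomorphisms. *)
Lemma fib_square_qis M M' N (g : dgHom M N) (s : dgHom M' N)
    (psi := dgh_sub (dgh_comp g (dgh_fst M M')) (dgh_comp s (dgh_snd M M')))
    (p := dgh_comp (dgh_fst M M') (fib_proj psi)) :
  quasi_iso s -> quasi_iso p.
Proof.
move=> qs i; have [si ss] := qs i; have [si1 ss1] := qs (i - 1); split.
  move=> [[m m'] y] cx /= /(coboundaryP (subrK 1 i)) [m1 em].
  have [e1 e2 e3] : [/\ dif M erefl m = 0, dif M' erefl m' = 0 &
      cs N (fib_eq (erefl (i + 1))) (g i m - s i m')
        = dif N (fib_eq1 (erefl (i + 1))) y].
    move: cx; rewrite /cocycle fib_difE /= sum_difE /=.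
    rewrite /sub_fun /= => -[-> -> /eqP]; rewrite subr_eq0 => /eqP ->.
    by split.
  have e4 : g i m - s i m' = dif N (subrK 1 i) y.
    apply: (@cs_inj _ _ _ _ (fib_eq (erefl (i + 1)))); rewrite e3.
    by rewrite (cs_dif _ _ (fib_eq1 (erefl (i + 1)))).
  have /si : coboundary (s i m').
    apply/(coboundaryP (subrK 1 i)); exists (g _ m1 - y).
    by rewrite linearB -e4 -dgh_dif -em opprB addrC subrK.
  move=> /(_ e2) /(coboundaryP (subrK 1 i)) [m1' em'].
  (* The primitives [m1] and [m1'] need not account for [y]. The error is a cocycle, hence
     cohomologous to the image of a cocycle [n2] of [M'], by which [m1'] is corrected. *)
  pose y' := y - (g _ m1 - s _ m1').
  have cy' : cocycle y'.
    apply/(cocycleP (subrK 1 i)).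
    by rewrite /y' 2!(linearB (dif N (subrK 1 i))) /= -e4 em em' -!dgh_dif subrr.
  have [n2 [cn2 /(coboundaryP (subrK 1 (i - 1))) [y2 ey2]]] := ss1 _ cy'.
  apply/(coboundaryP (subrK 1 i)); exists ((m1, m1' - n2), - y2).
  rewrite fib_difE /= sum_difE /= /sub_fun /=.
  move/(cocycleP (subrK 1 i)): cn2 => dn2.
  rewrite !linearB /= dn2 subr0 -em -em' !csE (linearN (dif N _)) !opprK.
  have -> : dif N (fib_eq1 (subrK 1 i)) y2 = dif N (subrK 1 (i - 1)) y2 by exact: dif_irr.
  rewrite -ey2 /y'.
  congr (_, _, _); move: (g _ _) (s _ m1') (s _ n2) => a b c.
  by rewrite (addrA a) -[y - _ - _]addrA -opprD [RHS]addrC subrK.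
move=> m cm; have cg : cocycle (g i m) by apply: dgh_cocycle.
have [m' [cm' /(coboundaryP (subrK 1 i)) [y ey]]] := ss _ cg.
exists ((m, m'), y); split; last first.
  by rewrite /= subrr; apply: coboundary0.
rewrite /cocycle fib_difE /= sum_difE /= /sub_fun /=.
rewrite cm cm' ey (cs_dif _ _ (fib_eq1 (erefl (i + 1)))) subrr.
by [].
Qed.

Lemma Dinv_comp M N P (s : dgHom M N) (t : dgHom N P) (qs : quasi_iso s)
    (qt : quasi_iso t) (qts : quasi_iso (dgh_comp t s)) :
  Deq (Dcomp (Dinv qs) (Dinv qt)) (Dinv qts).
Proof.
apply: (Deq_cancelr (Diso_qis qts)).
apply: Deq_trans _ (Deq_sym (Deq_invl qts)).
apply: Deq_trans (Deq_compl _ (Deq_sym (Deq_map t s))) _.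
apply: Deq_trans (Deq_assoc _ _ _) _.
apply: Deq_trans (Deq_compr _ _) (Deq_invl qs).
apply: Deq_trans (Deq_sym (Deq_assoc _ _ _)) _.
apply: Deq_trans (Deq_compl _ (Deq_invl qt)) _.
exact: Deq_idr.
Qed.

(** By induction on the formal composite; only a composite of two roofs needs the Ore condition. *)
Lemma Dhom_roof M N (f : Dhom M N) :
  exists M' (s : dgHom M' M) (qs : quasi_iso s) (g : dgHom M' N),
    Deq f (Dcomp (Dmap g) (Dinv qs)).
Proof.
elim: f => {M N} [M N f|M N s qs|M N P g [N' [s2 [q2 [g2 e2]]]] f
    [M' [s1 [q1 [g1 e1]]]]].
- exists M, (dgh_id M), (quasi_iso_id M), f.
  have h : Deq (Dinv (quasi_iso_id M)) (Did M).
    apply: Deq_trans (Deq_sym (Deq_idr _)) _; exact: Deq_invl.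
  by apply: Deq_trans (Deq_compl _ (Deq_sym h)); exact/Deq_sym/Deq_idr.
- by exists M, s, qs, (dgh_id M); apply/Deq_sym/Deq_idl.
(* In the homotopy pullback of [g1] and [s2] one has g1 p = s2 q with [p] a quasi-isomorphism, so
   the inverse of [s2] after [g1] is [q] after the inverse of [p]. *)
- have qp := fib_square_qis g1 q2.
  have sq := Deq_fib_square g1 s2.
  cbv zeta in qp, sq.
  set p := dgh_comp (dgh_fst _ _) _ in qp sq.
  set q := dgh_comp (dgh_snd _ _) _ in sq.
  exists _, (dgh_comp s1 p), (quasi_iso_comp q1 qp), (dgh_comp g2 q).
  apply: Deq_trans (Deq_comp e2 e1) _.
  apply: Deq_trans (Deq_compl _ (Dinv_comp qp q1 _)).
  apply: Deq_trans (Deq_assoc _ _ _) _.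
  apply: Deq_trans _ (Deq_sym (Deq_assoc _ _ _)); apply: Deq_compr.
  apply: (Deq_cancelr (Diso_qis qp)).
  have pK : Deq (Dcomp (Dcomp (Dmap (dgh_comp g2 q)) (Dinv qp)) (Dmap p))
      (Dmap (dgh_comp g2 q)).
    apply: Deq_trans (Deq_sym (Deq_assoc _ _ _)) _.
    by apply: Deq_trans (Deq_compl _ (Deq_invl qp)) _; apply: Deq_idr.
  apply: Deq_trans _ (Deq_sym pK).
  apply: Deq_trans (Deq_sym (Deq_assoc _ _ _)) _.
  apply: Deq_trans (Deq_sym (Deq_assoc _ _ _)) _.
  apply: Deq_trans (Deq_compl _ _) (Deq_map _ _).
  apply: Deq_trans (Deq_compl _ (Deq_trans (Deq_map _ _) sq)) _.
  apply: Deq_trans (Deq_compl _ (Deq_sym (Deq_map _ _))) _.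
  apply: Deq_trans (Deq_assoc _ _ _) _.
  apply: Deq_trans (Deq_compr _ (Deq_invl q2)) _.
  exact: Deq_idl.
Qed.

End Roofs.

(** * The action of morphisms on cohomology *)

Section CohomologyAction.
Variables (k : fieldType) (A : dgAlgebra k).
Implicit Types M N P : dgModule A.

(* [Hact f x y]: H^i(f) sends the class of x to the class of y. *)
Fixpoint Hact M N (f : Dhom M N) (i : int) : M i -> N i -> Prop :=
  match f in Dhom M N return M i -> N i -> Prop with
  | Dmap M N f => fun x y => coboundary (y - f i x)
  | Dinv M N s _ => fun x y => coboundary (x - s i y)
  | Dcomp M N P g f =>
      fun x z => exists y : N i, [/\ cocycle y, Hact f x y & Hact g y z]
  end.

Lemma Hact_total M N (f : Dhom M N) i (x : M i) :
  cocycle x -> exists2 y : N i, cocycle y & Hact f x y.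
Proof.
elim: f x => {M N} [M N f|M N s qs|M N P g IHg f IHf] x cx /=.
- exists (f i x); first exact: dgh_cocycle.
  by rewrite subrr; apply: coboundary0.
- by have [_ /(_ x cx) [y [cy hy]]] := qs i; exists y.
- have [y cy hy] := IHf x cx; have [z cz hz] := IHg y cy.
  by exists z => //; exists y.
Qed.

Lemma Hact_lin M N (f : Dhom M N) i (a : k) (x x' : M i) (y y' : N i) :
  Hact f x y -> Hact f x' y' -> Hact f (a *: x + x') (a *: y + y').
Proof.
elim: f x x' y y' => {M N} [M N f|M N s qs|M N P g IHg f IHf] x x' y y' /=.
- move=> h h'; rewrite linearP opprD addrACA -scalerN -scalerDr.
  exact/coboundaryD/h'/coboundaryZ.
- move=> h h'; rewrite linearP opprD addrACA -scalerN -scalerDr.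
  exact/coboundaryD/h'/coboundaryZ.
- move=> [z [cz h1 h2]] [z' [cz' h1' h2']]; exists (a *: z + z'); split.
  + by apply/cocycleD/cz'/cocycleZ.
  + exact: IHf.
  + exact: IHg.
Qed.

Lemma Hact_coboundary M N (f : Dhom M N) i (x : M i) (y : N i) :
  cocycle y -> coboundary x -> Hact f x y <-> coboundary y.
Proof.
elim: f x y => {M N} [M N f|M N s qs|M N P g IHg f IHf] x y cy bx /=.
- have bfx := dgh_coboundary f bx; split=> h; last exact: coboundaryB.
  by rewrite -[y](subrK (f i x)); apply: coboundaryD.
- split=> h; last by apply: coboundaryB => //; apply: dgh_coboundary.
  have [/(_ y cy) h' _] := qs i; apply: h'.
  by rewrite -[s i y](subKr x); apply: coboundaryB.
- split=> [[z [cz /(IHf _ _ cz bx) bz /(IHg _ _ cy bz)]] //|hy].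
  exists 0; split; first exact: cocycle0.
  + by apply/(IHf _ _ _ bx); [exact: cocycle0|exact: coboundary0].
  + by apply/(IHg _ _ cy) => //; exact: coboundary0.
Qed.

Lemma HactZ M N (f : Dhom M N) i a (x : M i) (y : N i) :
  Hact f x y -> Hact f (a *: x) (a *: y).
Proof.
move=> h; rewrite -[a *: x]addr0 -[a *: y]addr0; apply: Hact_lin => //.
by apply/Hact_coboundary; [exact: cocycle0|exact: coboundary0..].
Qed.

Lemma HactB M N (f : Dhom M N) i (x x' : M i) (y y' : N i) :
  Hact f x y -> Hact f x' y' -> Hact f (x - x') (y - y').
Proof.
by move=> h h'; rewrite addrC [y - _]addrC -!scaleN1r; apply: Hact_lin.
Qed.

Lemma Hact_cohom M N (f : Dhom M N) i (x x' : M i) (y y' : N i) :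
  cocycle y -> cocycle y' -> coboundary (x - x') ->
  Hact f x y -> Hact f x' y' <-> coboundary (y - y').
Proof.
move=> cy cy' bx h; split=> h'.
  apply/(Hact_coboundary f _ bx); [exact: cocycleB|exact: HactB].
rewrite -[x'](subKr x) -[y'](subKr y); apply: HactB => //.
by apply/(Hact_coboundary f _ bx) => //; exact: cocycleB.
Qed.

Lemma HactE M N (f : Dhom M N) i (x : M i) (y y' : N i) :
  cocycle y -> cocycle y' -> Hact f x y ->
  Hact f x y' <-> coboundary (y - y').
Proof.
by move=> cy cy'; apply: Hact_cohom => //; rewrite subrr; apply: coboundary0.
Qed.

Lemma Hact_id M i (x y : M i) : Hact (Did M) x y <-> coboundary (x - y).
Proof. by split=> /coboundaryC. Qed.

(** Every generator of [Deq] is respected, as H^i is a functor making quasi-isomorphisms bijective.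
    Kernels, images and ranks on cohomology thus make sense for morphisms of D(A). *)
Lemma Deq_Hact M N (f g : Dhom M N) : Deq f g ->
  forall i (x : M i) (y : N i), cocycle x -> cocycle y ->
  Hact f x y <-> Hact g x y.
Proof.
elim=> {M N f g}.
- by [].
- by move=> M N f g _ IH i x y cx cy; split=> /IH; apply.
- by move=> M N f g h _ IH1 _ IH2 i x y cx cy; rewrite IH1 // IH2.
- move=> M N P g g' f f' _ IHg _ IHf i x z cx cz /=.
  by split=> -[y [cy hf hg]]; exists y; split=> //; first [apply/IHf|apply/IHg].
- move=> M N P Q h g f i x w cx cw /=; split.
  + by move=> [z [cz [y [cy hf hg]] hh]]; exists y; split=> //; exists z.
  + by move=> [y [cy hf [z [cz hg hh]]]]; exists z; split=> //; exists y.
- move=> M N f i x y cx cy /=; split=> [[z [cz hf hz]]|hf].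
    by apply/(HactE cz cy hf); apply/coboundaryC.
  by exists y; split=> //=; rewrite subrr; apply: coboundary0.
- move=> M N f i x y cx cy /=; split=> [[z [cz hz hf]]|hf].
    have [w cw hw] := Hact_total f cx.
    apply/(HactE cw cy hw).
    by apply/(Hact_cohom cw cy _ hw)/hf; apply/coboundaryC.
  by exists x; split=> //=; rewrite subrr; apply: coboundary0.
- by move=> M N f f' ff' i x y cx cy /=; rewrite ff'.
- move=> M N P g f i x z cx cz /=; split=> [[y [cy hf hg]]|h].
    apply: coboundary_trans hg _; rewrite -linearB; exact: dgh_coboundary.
  exists (f i x); split=> //; first exact: dgh_cocycle.
  by rewrite subrr; apply: coboundary0.
- move=> M N s qs i x y cx cy /=; split=> [[z [cz hz hs]]|h].
    have [hi _] := qs i; apply: hi; first exact: cocycleB.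
    rewrite linearB; have := coboundaryB hz hs.
    by rewrite opprB addrC subrKA.
  exists (s i x); split; [exact: dgh_cocycle| |].
    by rewrite subrr; apply: coboundary0.
  by rewrite -linearB; apply/dgh_coboundary/coboundaryC.
- move=> M N s qs i x y cx cy /=; split=> [[z [cz hz hs]]|h].
    exact: coboundary_trans hs (coboundaryC hz).
  have [_ /(_ x cx) [z [cz hz]]] := qs i.
  by exists z; split=> //; apply: coboundary_trans h hz.
Qed.

Lemma Hact_cocycle_map M N (f : dgHom M N) i (x : M i) : Hact (Dmap f) x (f i x).
Proof. by rewrite /= subrr; apply: coboundary0. Qed.

Definition Hinj M N (f : Dhom M N) (i : int) : Prop :=
  forall (x : M i) (y : N i), cocycle x -> coboundary y -> Hact f x y ->
  coboundary x.

Definition Hsurj M N (f : Dhom M N) (i : int) : Prop :=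
  forall y : N i, cocycle y -> exists2 x : M i, cocycle x & Hact f x y.

Definition Hbij M N (f : Dhom M N) (i : int) : Prop := Hinj f i /\ Hsurj f i.

Definition Hzero M N (f : Dhom M N) (i : int) : Prop :=
  forall (x : M i) (y : N i), cocycle x -> cocycle y -> Hact f x y ->
  coboundary y.

Lemma Deq_Hinj M N (f g : Dhom M N) i : Deq f g -> Hinj f i -> Hinj g i.
Proof.
move=> fg h x y cx by_ /(Deq_Hact fg cx (coboundary_cocycle by_)).
exact: h.
Qed.

Lemma Deq_Hsurj M N (f g : Dhom M N) i : Deq f g -> Hsurj f i -> Hsurj g i.
Proof.
by move=> fg h y cy; have [x cx hx] := h y cy; exists x => //; apply/(Deq_Hact fg).
Qed.

Lemma Deq_Hzero M N (f g : Dhom M N) i : Deq f g -> Hzero f i -> Hzero g i.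
Proof. by move=> fg h x y cx cy /(Deq_Hact fg cx cy); apply: h. Qed.

Lemma Hinj_comp M N P (g : Dhom N P) (f : Dhom M N) i :
  Hinj g i -> Hinj f i -> Hinj (Dcomp g f) i.
Proof.
by move=> hg hf x z cx bz /= [y [cy hxy hyz]]; apply: (hf x y) => //;
  apply: (hg y z).
Qed.

Lemma Hsurj_comp M N P (g : Dhom N P) (f : Dhom M N) i :
  Hsurj g i -> Hsurj f i -> Hsurj (Dcomp g f) i.
Proof.
move=> hg hf z cz; have [y cy hy] := hg z cz; have [x cx hx] := hf y cy.
by exists x => //; exists y.
Qed.

Lemma Hbij_comp M N P (g : Dhom N P) (f : Dhom M N) i :
  Hbij g i -> Hbij f i -> Hbij (Dcomp g f) i.
Proof. by move=> [? ?] [? ?]; split; [exact: Hinj_comp|exact: Hsurj_comp]. Qed.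

Lemma Hinj_of_comp M N P (g : Dhom N P) (f : Dhom M N) i :
  Hinj (Dcomp g f) i -> Hinj f i.
Proof.
move=> h x y cx by_ hf; apply: (h x 0 cx (coboundary0 _ _)); exists y.
split=> //; first exact: coboundary_cocycle.
by apply/Hact_coboundary => //; [exact: cocycle0|exact: coboundary0].
Qed.

Lemma Hsurj_of_comp M N P (g : Dhom N P) (f : Dhom M N) i :
  Hsurj (Dcomp g f) i -> Hsurj g i.
Proof. by move=> h z /h [x cx [y [cy _ hg]]]; exists y. Qed.

Lemma Hzero_compr M N P (g : Dhom N P) (f : Dhom M N) i :
  Hzero g i -> Hzero (Dcomp g f) i.
Proof. by move=> h x z cx cz [y [cy hf hg]]; apply: (h y z). Qed.

Lemma Hbij_id M i : Hbij (Did M) i.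
Proof.
split=> [x y cx by_|y cy].
  by move/Hact_id => h; rewrite -[x](subrK y); apply: coboundaryD.
by exists y => //; apply/Hact_id; rewrite subrr; apply: coboundary0.
Qed.

Lemma Diso_Hbij M N (f : Dhom M N) i : is_Diso f -> Hbij f i.
Proof.
move=> [g [gf fg]]; split.
  apply: (@Hinj_of_comp _ _ _ g); apply: (Deq_Hinj (Deq_sym gf)).
  by case: (Hbij_id M i).
apply: (@Hsurj_of_comp _ _ _ f g); apply: (Deq_Hsurj (Deq_sym fg)).
by case: (Hbij_id N i).
Qed.

Lemma Hbij_quasi_iso M N (f : dgHom M N) :
  (forall i, Hbij (Dmap f) i) <-> quasi_iso f.
Proof.
split=> [h i|qf i]; last exact/Diso_Hbij/Diso_qis.
have [hi hs] := h i; split=> [x cx bfx|y /hs [x cx hx]]; last by exists x.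
exact: (hi x (f i x) cx bfx (Hact_cocycle_map _ _)).
Qed.

Lemma Deq_Diso M N (f g : Dhom M N) : Deq f g -> is_Diso f -> is_Diso g.
Proof.
move=> fg [f' [h1 h2]]; exists f'; split.
- by apply: Deq_trans h1; apply/Deq_compl/Deq_sym.
- by apply: Deq_trans h2; apply/Deq_compr/Deq_sym.
Qed.

Lemma Hinj_cancel M N P (g : Dhom N P) (f : Dhom M N) i :
  Hinj (Dcomp g f) i -> Hsurj f i -> Hinj g i.
Proof.
move=> h sf y z cy bz hg; have [x cx hx] := sf y cy.
have bx : coboundary x by apply: (h x z cx bz); exists y.
exact/(Hact_coboundary f cy bx).
Qed.

Lemma Hsurj_cancel M N P (g : Dhom N P) (f : Dhom M N) i :
  Hsurj (Dcomp g f) i -> Hinj g i -> Hsurj f i.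
Proof.
move=> h ig y cy; have [z cz hz] := Hact_total g cy.
have [x cx [y' [cy' hf hg]]] := h z cz.
exists x => //; apply/(HactE cy' cy hf).
apply: (ig _ (z - z)); [exact: cocycleB| |exact: HactB].
by rewrite subrr; apply: coboundary0.
Qed.

(** In a roof for [f] the denominator is bijective on cohomology, hence so is the numerator, which
    is therefore a quasi-isomorphism. *)
Lemma Hbij_Diso M N (f : Dhom M N) : (forall i, Hbij f i) -> is_Diso f.
Proof.
move=> h; have [M' [s [qs [g e]]]] := Dhom_roof f.
apply: (Deq_Diso (Deq_sym e)); apply: Diso_comp (Diso_inv qs).
apply/Diso_qis/Hbij_quasi_iso => i.
have [hi hs] := h i; have [si ss] := Diso_Hbij i (Diso_inv qs); split.
  exact: Hinj_cancel (Deq_Hinj e hi) ss.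
exact: Hsurj_of_comp (Deq_Hsurj e hs).
Qed.

Lemma Deq_comp0 M N P (g : Dhom N P) : Deq (Dcomp g (Dzero M N)) (Dzero M P).
Proof.
have map0 N' P' (u : dgHom N' P') : Deq (Dcomp (Dmap u) (Dzero M N')) (Dzero M P').
  by apply: Deq_trans (Deq_map _ _) _; apply: Deq_ext => i x; apply: linear0.
have [N' [s [qs [u e]]]] := Dhom_roof g.
apply: Deq_trans (Deq_compr _ e) _.
apply: Deq_trans (Deq_sym (Deq_assoc _ _ _)) _.
apply: Deq_trans (map0 _ _ u); apply: Deq_compl.
apply: Deq_trans (Deq_compl _ (Deq_sym (map0 _ _ s))) _.
apply: Deq_trans (Deq_assoc _ _ _) _.
by apply: Deq_trans (Deq_compr _ (Deq_invl qs)) _; apply: Deq_idl.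
Qed.

Lemma Deq_0comp M N P (f : Dhom M N) : Deq (Dcomp (Dzero N P) f) (Dzero M P).
Proof.
have map0 N' P' M' (u : dgHom M' N') :
    Deq (Dcomp (Dzero N' P') (Dmap u)) (Dzero M' P').
  by apply: Deq_trans (Deq_map _ _) _; apply: Deq_ext => i x.
have [M' [s [qs [u e]]]] := Dhom_roof f.
apply: Deq_trans (Deq_compl _ e) _.
apply: Deq_trans (Deq_assoc _ _ _) _.
apply: Deq_trans (Deq_compr _ (map0 _ _ _ u)) _.
apply: Deq_trans (Deq_compr _ (Deq_sym (map0 _ _ _ s))) _.
apply: Deq_trans (Deq_sym (Deq_assoc _ _ _)) _.
by apply: Deq_trans (Deq_compl _ (Deq_invr qs)) _; apply: Deq_idr.
Qed.

Lemma coh_zero_dg_zero i : coh_zero (dg_zero A) i.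
Proof.
move=> x _; have -> : x = 0 by apply/rowP; case.
exact: coboundary0.
Qed.

Lemma Disomorphic_zero M :
  Disomorphic M (dg_zero A) <-> (forall i, coh_zero M i).
Proof.
split=> [[f fiso] i x cx|h].
  have [fi _] := Diso_Hbij i fiso; have [y cy hy] := Hact_total f cx.
  by apply: (fi _ _ cx _ hy); apply: coh_zero_dg_zero.
exists (Dzero M _); apply: Hbij_Diso => i; split.
  by move=> x y cx _ _; apply: h.
move=> y cy; exists 0; first exact: cocycle0.
by apply/Hact_coboundary => //; [exact: coboundary0|exact: coh_zero_dg_zero].
Qed.

(** An acyclic module is isomorphic to the zero module, and a morphism to the latter is zero because
    the numerator of its roof is. *)
Lemma Deq_through_acyclic M N P (g : Dhom N P) (f : Dhom M N) :
  (forall i, coh_zero N i) -> Deq (Dcomp g f) (Dzero M P).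
Proof.
move=> /Disomorphic_zero [u [v [vu _]]].
have u0 : Deq (Dcomp u f) (Dzero M (dg_zero A)).
  have [M' [s [qs [w e]]]] := Dhom_roof (Dcomp u f).
  apply: Deq_trans e _; apply: Deq_trans (Deq_0comp _ (Dinv qs)).
  by apply: Deq_compr; apply: Deq_ext => i x; apply/rowP; case.
apply: Deq_trans (Deq_compr _ (Deq_sym (Deq_idr g))) _.
apply: Deq_trans (Deq_compr _ (Deq_compl _ (Deq_sym vu))) _.
apply: Deq_trans (Deq_compr _ (Deq_assoc _ _ _)) _.
apply: Deq_trans (Deq_sym (Deq_assoc _ _ _)) _.
by apply: Deq_trans (Deq_compl _ u0) _; apply: Deq_comp0.
Qed.

End CohomologyAction.

(** * Killing cohomology *)

(* Hom_k(A, U), with U placed in degree n. *)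
Section Coinduced.
Variables (k : fieldType) (A : dgAlgebra k) (U : lmodType k) (n : int).

Definition coind_prop j (f : A (n - j) -> U) : Prop :=
  forall (c : k) a b, f (c *: a + b) = c *: f a + f b.

Fact coind_closed j : fam_closed (V := fun _ : A (n - j) => U) (@coind_prop j).
Proof.
split=> [c a b|c f g hf hg u a b]; first by rewrite scaler0 addr0.
rewrite hf hg !scalerDr !scalerA (mulrC u) !addrA; congr (_ + _).
by rewrite -!addrA; congr (_ + _); apply: addrC.
Qed.

Definition coind_obj j : lmodType k := subprod_of (coind_closed j).

Fact coind_eqd i j (e : i + 1 = j) : n - j + 1 = n - i.
Proof. by lia. Qed.

Fact coind_eqa i j l (e : i + j = l) : j + (n - l) = n - i.
Proof. by lia. Qed.

Fact coind_dif_prop i j (e : i + 1 = j) (f : coind_obj i) :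
  coind_prop (fun b : A (n - j) => (-1) ^ j *: f (dif A (coind_eqd e) b)).
Proof.
move=> c a b; rewrite linearP (sp_prop f) scalerDr !scalerA.
by rewrite (mulrC c).
Qed.

Definition coind_dif i j (e : i + 1 = j) (f : coind_obj i) : coind_obj j :=
  SubProd (coind_closed j) (coind_dif_prop e f).

Fact coind_dif_linear i j (e : i + 1 = j) : linear (@coind_dif i j e).
Proof.
move=> c f g; apply: sp_ext => b /=.
by rewrite scalerDr !scalerA (mulrC c).
Qed.

HB.instance Definition _ i j (e : i + 1 = j) :=
  GRing.isLinear.Build k (coind_obj i) (coind_obj j) _
    (@coind_dif i j e) (@coind_dif_linear i j e).

Lemma coind0 j (f : coind_obj j) : f 0 = 0.
Proof. by have := sp_prop f (-1) 0 0; rewrite !scaleN1r !addNr. Qed.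

Lemma coindZ j (f : coind_obj j) c a : f (c *: a) = c *: f a.
Proof. by have := sp_prop f c a 0; rewrite coind0 !addr0. Qed.

Lemma coindD j (f : coind_obj j) a b : f (a + b) = f a + f b.
Proof. by have := sp_prop f 1 a b; rewrite !scale1r. Qed.

Definition coind_cx : complex k.
Proof.
apply: (@Complex k coind_obj (fun i j e => @coind_dif i j e)).
move=> i j l e e' f; apply: sp_ext => b /=.
by rewrite dif_dif coind0 !scaler0.
Defined.

Lemma coind_difE i j (e : i + 1 = j) (f : coind_cx i) b :
  dif coind_cx e f b = (-1) ^ j *: f (dif A (coind_eqd e) b).
Proof. by []. Qed.

Lemma cs_coind i j (e : i = j) (e' : n - j = n - i) (f : coind_cx i) b :
  cs coind_cx e f b = f (cs A e' b).
Proof. by subst; rewrite !csE. Qed.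

Fact coind_act_prop i j l (e : i + j = l) (f : coind_cx i) (a : A j) :
  coind_prop (fun b : A (n - l) => f (dg_mul (coind_eqa e) a b)).
Proof. by move=> c b b'; rewrite dg_mul_linr (sp_prop f). Qed.

Definition coind_act i j l (e : i + j = l) (f : coind_cx i) (a : A j) :
  coind_cx l := SubProd (coind_closed l) (coind_act_prop e f a).

Definition dg_coind : dgModule A.
Proof.
apply: (@DgModule k A coind_cx coind_act).
- by move=> i j l e c x y a; apply: sp_ext => b.
- by move=> i j l e c x a a'; apply: sp_ext => b /=;
    rewrite dg_mul_linl (sp_prop x).
- move=> i j l ij jl m e1 e2 e3 e4 x a a'; apply: sp_ext => b /=; congr (x _).
  have e5 : l + (n - m) = n - ij by lia.
  have e6 : jl + (n - m) = n - i by lia.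
  by rewrite (dg_mulA e3 (coind_eqa e4) (coind_eqa e2) (coind_eqa e1)).
- by move=> i e x; apply: sp_ext => b /=; rewrite dg_mul1l.
- move=> i j l i' j' l' e ei ej el e1 e2 x a; apply: sp_ext => b.
  rewrite /=.
  rewrite (dg_leibniz (coind_eqa e1) ej (coind_eqd el) (coind_eqd ei)
    (coind_eqa e2) (coind_eqa e)).
  have s1 : (-1 : k) ^ i' = - (-1) ^ i by rewrite -ei sgnS.
  have s2 : (-1 : k) ^ i' * (-1) ^ j = (-1) ^ l'.
    by rewrite -expfzDr ?oppr_eq0 ?oner_neq0 // e1.
  rewrite coindD coindZ scalerDr scalerA s2 s1 scaleNr.
  by rewrite addrAC addNr add0r.
Defined.

Hypothesis A_conn : dg_connective A.

(** H^j is Hom_k(H^(n-j)(A), U), and n - j > 0. Concretely, a cocycle [f] vanishes on the cocycles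
    of [A], so it factors through the differential. *)
Lemma coind_acyclic j : j < n -> coh_zero dg_coind j.
Proof.
move=> ltjn f /(congr1 (fun g : coind_obj _ => sp_fun g)) /= cf.
have fd b : f (dif A (coind_eqd (erefl (j + 1))) b) = 0.
  have := congr1 (fun g => g b) cf; rewrite /= => /eqP.
  by rewrite scaler_eq0 expfz_eq0 oppr_eq0 oner_eq0 andbF => /eqP.
have fc a : cocycle a -> f a = 0.
  have lt0 : 0 < n - j by lia.
  by move/(A_conn lt0)/(coboundaryP (coind_eqd (erefl (j + 1)))) => [b ->].
pose f' : A (n - j) -> U := f.
have lf : linear f' by move=> c a b; apply: (sp_prop f).
pose fl : {linear A (n - j) -> U} := HB.pack f' (GRing.isLinear.Build _ _ _ _ f' lf).
have e1 := coind_eqd (subrK 1 j).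
have [|g fg] := @linear_factor _ _ _ _ (dif A e1) fl.
  by move=> a da; apply: fc; apply/(cocycleP e1).
apply/(coboundaryP (subrK 1 j)).
have pg : coind_prop (fun b : A (n - (j - 1)) => (-1) ^ j *: g b).
  by move=> c a b; rewrite linearP scalerDr !scalerA (mulrC c).
exists (SubProd (coind_closed (j - 1)) pg); apply: sp_ext => b.
rewrite coind_difE /= (dif_irr _ e1) -fg scalerA.
by rewrite -expfzMl mulrNN mulr1 exp1rz scale1r.
Qed.

End Coinduced.

Section CoindMap.
Variables (k : fieldType) (A : dgAlgebra k) (U : lmodType k) (n : int).
Variables (K : dgModule A) (pi : {linear K n -> U}).
Hypothesis pi_dif : forall i (e : i + 1 = n) (x : K i), pi (dif K e x) = 0.

Fact coind_map_eq (j : int) : j + (n - j) = n.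
Proof. by lia. Qed.

Fact coind_map_prop j (x : K j) :
  coind_prop (fun b : A (n - j) => pi (dg_act (coind_map_eq j) x b)).
Proof. by move=> c a b; rewrite dg_act_linr linearP. Qed.

Definition coind_map_fun j (x : K j) : dg_coind A U n j :=
  SubProd (@coind_closed k A U n j) (coind_map_prop x).

Fact coind_map_linear j : linear (@coind_map_fun j).
Proof. by move=> c x y; apply: sp_ext => b /=; rewrite dg_act_linl linearP. Qed.

HB.instance Definition _ j := GRing.isLinear.Build k (K j) (dg_coind A U n j) _
  (@coind_map_fun j) (@coind_map_linear j).

(** The coinduction adjunction: [pi] amounts to a map of complexes from [K] to U placed in degree n,
    and x goes to the linear map b |-> pi(xb). *)
Definition coind_map : dgHom K (dg_coind A U n).
Proof.
apply: (@DgHom k A K (dg_coind A U n) (fun j => @coind_map_fun j)).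
- move=> i j e x; apply: sp_ext => b /=.
  have e1 : i + (n - j) + 1 = n by lia.
  have := dg_act_leibniz (erefl (i + (n - j))) e (coind_eqd n e) e1
    (coind_map_eq j) (coind_map_eq i) x b.
  move/(congr1 pi); rewrite pi_dif linearD linearZ /= => /eqP.
  rewrite eq_sym addr_eq0 => /eqP ->.
  have -> : (-1 : k) ^ j = - (-1) ^ i by rewrite -e sgnS.
  by rewrite scaleNr.
- move=> i j l e x a; apply: sp_ext => b /=; congr (pi _).
  exact: dg_actA.
Defined.

Lemma coind_mapE j (x : K j) b :
  coind_map j x b = pi (dg_act (coind_map_eq j) x b).
Proof. by []. Qed.

End CoindMap.

Section Unit.
Variables (k : fieldType) (A : dgAlgebra k).

(** The Leibniz rule for 1 = 1 * 1 gives d(1) = d(1) + d(1). *)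
Lemma dif_one i (e : 0 + 1 = i) : dif A e (dg_one A) = 0.
Proof.
have e1 : i + 0 = i by lia.
have e2 : 0 + i = i by lia.
have := dg_leibniz (addr0 0) e e e e1 e2 (dg_one A) (dg_one A).
rewrite expr0z scale1r !dg_mul1r dg_mul1l => h.
by have := congr1 (fun z => z - dif A e (dg_one A)) h; rewrite subrr addrK.
Qed.

Lemma act_unit (M : dgModule A) i j (e : 0 = j) (e1 : i + j = i) (x : M i) :
  dg_act e1 x (cs A e (dg_one A)) = x.
Proof. by subst; rewrite csE dg_act1. Qed.

Lemma dif_unit i j (e : 0 = i) (e1 : i + 1 = j) :
  dif A e1 (cs A e (dg_one A)) = 0.
Proof. by subst i; rewrite csE dif_one. Qed.

End Unit.

Definition qinj (k : fieldType) (A : dgAlgebra k) (M N : dgModule A)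
    (f : dgHom M N) i : Prop :=
  forall x : M i, cocycle x -> coboundary (f i x) -> coboundary x.

Definition qsurj (k : fieldType) (A : dgAlgebra k) (M N : dgModule A)
    (f : dgHom M N) i : Prop :=
  forall y : N i, cocycle y -> exists2 x : M i, cocycle x & coboundary (y - f i x).

(** In the long exact sequence of the fibre, the kernel of H^i(fibre) -> H^i(X) is the cokernel of
    H^(i-1)(p). *)
Lemma fib_proj_qinj (k : fieldType) (A : dgAlgebra k) (X Y : dgModule A)
    (p : dgHom X Y) i :
  qsurj p (i - 1) -> qinj (fib_proj p) i.
Proof.
move=> sp [x y] cx /= /(coboundaryP (subrK 1 i)) [x1 ex].
pose z : dg_fib p i := (x, y).
have cz : cocycle (z - dif (dg_fib p) (subrK 1 i) (x1, 0)).
  by apply: cocycleB => //; apply: cocycle_dif.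
pose y1 := y - cs Y (fib_eq (subrK 1 i)) (p _ x1).
have ez : z - dif (dg_fib p) (subrK 1 i) (x1, 0) = (0, y1).
  rewrite /z /y1 fib_difE /= linear0 subr0 -ex.
  have -> : 0 = x - x by rewrite subrr.
  by [].
have dy1 : dif Y (fib_eq1 (erefl (i + 1))) y1 = 0.
  move: cz; rewrite ez /cocycle fib_difE => /(congr1 snd) /= /eqP.
  by rewrite !linear0 add0r oppr_eq0 => /eqP.
have cy1 : cocycle y1 by apply/(cocycleP (fib_eq1 (erefl (i + 1)))).
have [x2 cx2 /(coboundaryP (fib_eq1 (subrK 1 i))) [y2 ey2]] := sp _ cy1.
apply/(coboundaryP (subrK 1 i)); exists (x1 + x2, - y2).
rewrite -/z; have -> : z = dif (dg_fib p) (subrK 1 i) (x1, 0) + (0, y1).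
  by rewrite -ez [RHS]addrC subrK.
rewrite !fib_difE /= (linearN (dif Y _)) linear0 subr0 opprK -ey2.
move/(cocycleP (subrK 1 i)): cx2 => cx2.
rewrite (linearD (dif X _)) cx2 !(linearD (p _)) linearD.
transitivity (dif X (subrK 1 i) x1 + 0,
  cs Y (fib_eq (subrK 1 i)) (p _ x1) + y1); first by [].
by congr (_, _); rewrite !csE -addrA [p _ x2 + _]addrC subrK.
Qed.

(** In the same exact sequence, the obstruction to lifting a class of H^i(X) lies in H^i(N). *)
Lemma fib_proj_qsurj (k : fieldType) (A : dgAlgebra k) (X N : dgModule A)
    (psi : dgHom X N) i :
  coh_zero N i -> qsurj (fib_proj psi) i.
Proof.
move=> zN x cx; have := zN _ (dgh_cocycle psi cx).
move/(coboundaryP (subrK 1 i)) => [y ey].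
exists (x, y); last by rewrite /= subrr; apply: coboundary0.
rewrite /cocycle fib_difE /= ey (cs_dif _ _ (fib_eq1 (erefl (i + 1)))).
by rewrite subrr cx.
Qed.

Section ConeDetection.
Variables (k : fieldType) (A : dgAlgebra k) (W K : dgModule A).
Variable phi : dgHom W K.

(* The cohomology of the cone of phi vanishes in degree j. *)
Definition cone_zero (j : int) : Prop :=
  forall (x : K j) (w : W (j + 1)), dif K (erefl (j + 1)) x + phi (j + 1) w = 0 ->
  cocycle w -> exists (x1 : K (j - 1)) (w1 : W j),
    x = dif K (subrK 1 j) x1 + phi j w1 /\ w = - dif W (erefl (j + 1)) w1.

Variable n : int.

Definition cone_dif (x : K (n - 1) * W n) : K n * W (n + 1) :=
  (dif K (subrK 1 n) x.1 + phi n x.2, - dif W (erefl (n + 1)) x.2).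

Fact cone_dif_linear : linear cone_dif.
Proof.
move=> c [x w] [x' w']; rewrite /cone_dif /= !linearP /=; congr (_, _).
by rewrite addrACA -scalerDr.
Qed.

HB.instance Definition _ := GRing.isLinear.Build k (K (n - 1) * W n)%type
  (K n * W (n + 1)%R)%type _ cone_dif cone_dif_linear.

(* Maps (pi, theta) killing the coboundaries of the cone of phi, and nothing
   more, in degree n. *)
Lemma cone_detect :
  exists (U : lmodType k) (pi : {linear K n -> U}) (theta : {linear W (n + 1) -> U}),
  [/\ forall i (e : i + 1 = n) (x : K i), pi (dif K e x) = 0,
      forall w : W n, pi (phi n w) = theta (dif W (erefl (n + 1)) w)
    & forall x w, pi x + theta w = 0 -> exists (x1 : K (n - 1)) (w1 : W n),
        x = dif K (subrK 1 n) x1 + phi n w1 /\ w = - dif W (erefl (n + 1)) w1].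
Proof.
have [s sP] := @linear_pseudo_inverse _ _ _ cone_dif.
pose U : lmodType k := (K n * W (n + 1)%R)%type.
(* [rho] has kernel exactly the image of [cone_dif], so it plays the role of the quotient by the
   coboundaries of the cone. *)
pose rho (x : U) : U := x - cone_dif (s x).
have rho_lin : linear rho.
  by move=> c x y; rewrite /rho !linearP /= scalerDr addrACA.
have rho_dif x : rho (cone_dif x) = 0 by rewrite /rho sP subrr.
pose pi (x : K n) : U := rho (x, 0).
pose theta (w : W (n + 1)) : U := rho (0, w).
have pi_lin : linear pi.
  move=> c x y; rewrite /pi -rho_lin.
  transitivity (rho (c *: x + y, c *: 0 + 0)); last by [].
  by rewrite scaler0 addr0.
have theta_lin : linear theta.
  move=> c x y; rewrite /theta -rho_lin.
  transitivity (rho (c *: 0 + 0, c *: x + y)); last by [].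
  by rewrite scaler0 addr0.
have pt x w : pi x + theta w = rho (x, w).
  rewrite /pi /theta -[rho (x, 0)]scale1r -rho_lin scale1r.
  transitivity (rho (x + 0, 0 + w)); first by [].
  by rewrite addr0 add0r.
pose pi' : {linear K n -> U} :=
  HB.pack pi (GRing.isLinear.Build _ _ _ _ pi pi_lin).
pose theta' : {linear W (n + 1) -> U} :=
  HB.pack theta (GRing.isLinear.Build _ _ _ _ theta theta_lin).
exists U, pi', theta'; split=> /=.
- move=> i e x; have ei : i = n - 1 by lia.
  subst i; rewrite -[RHS](rho_dif (x, 0)) /pi /cone_dif /= !linear0 addr0.
  by rewrite (dif_irr _ e).
- move=> w; apply/eqP; rewrite -subr_eq0 -[- theta _]scaleN1r.
  have := theta_lin (-1) (dif W (erefl (n + 1)) w) 0.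
  have -> : theta 0 = 0.
    by have := theta_lin (-1) 0 0; rewrite !scaleN1r !addNr.
  rewrite !addr0 => <-; rewrite pt scaleN1r -[X in _ == X](rho_dif (0, w)).
  by rewrite /cone_dif /= linear0 add0r.
- move=> x w; rewrite pt /rho => /eqP; rewrite subr_eq0.
  by case: (s (x, w)) => x1 w1 /eqP [-> ->]; exists x1, w1.
Qed.

End ConeDetection.

Section KillingStep.
Variables (k : fieldType) (A : dgAlgebra k) (A_conn : dg_connective A).
Variables (W K : dgModule A) (phi : dgHom W K) (n : int).

(** The maps [pi] and [theta] of [cone_detect] give a map from the cone of [phi] to a coinduced
    module J, injective on H^n. Its part on [K] is [psi], its part on [W] a null-homotopy of [psi]
    after [phi], so [phi] lifts to the fibre K' of [psi]. As J is acyclic below n, little changes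
    from K' to [K] in degrees <= n, while H^n of the cone dies. *)
Lemma killing_step :
  exists (K' : dgModule A) (p : dgHom K' K) (phi' : dgHom W K'),
  [/\ forall i w, p i (phi' i w) = phi i w,
      forall i x, exists x', p i x' = x,
      forall j, j <= n -> qinj p j,
      forall j, j < n -> qsurj p j
    & forall j, j <= n -> (j < n -> cone_zero phi j) -> cone_zero phi' j].
Proof.
have [U [pi [theta [pi_dif pi_phi detect]]]] := cone_detect phi n.
pose psi := coind_map pi_dif.
pose J := dg_coind A U n.
have h_eq (j : int) : j + (n - (j - 1)) = n + 1 by lia.
have h_prop j (w : W j) : coind_prop
    (fun b : A (n - (j - 1)) => theta (dg_act (h_eq j) w b)).
  by move=> c a b; rewrite dg_act_linr linearP.
(* The null-homotopy of [psi] after [phi]: w goes to b |-> theta(wb). *)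
pose hf j (w : W j) : J (j - 1) :=
  SubProd (@coind_closed k A U n (j - 1)) (h_prop j w).
have h_lin j : linear (hf j).
  by move=> c x y; apply: sp_ext => b /=; rewrite dg_act_linl linearP.
pose h j : {linear W j -> J (j - 1)} :=
  HB.pack (hf j) (GRing.isLinear.Build _ _ _ _ (hf j) (h_lin j)).
have h_dif i j (e : i + 1 = j) (w : W i) :
    h j (dif W e w) = cs J (fib_eq e) (psi i (phi i w)) - dif J (fib_eq1 e) (h i w).
  apply: sp_ext => b; apply/eqP; rewrite eq_sym subr_eq; apply/eqP.
  have e1 : n - (j - 1) = n - i by lia.
  have e2 : i + (n - (j - 1)) = n by lia.
  rewrite (cs_coind _ e1) coind_mapE (act_csr _ _ e2) -dgh_act pi_phi.
  have e3 : n - (j - 1) + 1 = n - (i - 1) by lia.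
  rewrite (dg_act_leibniz e2 e e3 (erefl (n + 1)) (h_eq j) (h_eq i)).
  have -> : (-1 : k) ^ i = (-1) ^ (j - 1) by congr (_ ^ _); lia.
  by rewrite linearD linearZ (dif_irr e3 (coind_eqd n (fib_eq1 e))).
have h_act i j l (e : i + j = l) (w : W i) (a : A j) :
    h l (dg_act e w a) = dg_act (fib_eqA e) (h i w) a.
  apply: sp_ext => b /=; congr (theta _); exact: dg_actA.
exists (dg_fib psi), (fib_proj psi), (fib_lift h_dif h_act); split.
- by [].
- by move=> i x; exists (x, 0).
- move=> j lejn; apply: fib_proj_qinj => y cy; exists 0; first exact: cocycle0.
  by rewrite linear0 subr0; apply: coind_acyclic cy => //; lia.
- by move=> j ltjn; apply: fib_proj_qsurj; apply: coind_acyclic.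
move=> j lejn cz [x y] w hw cw.
have [hx hy] : dif K (erefl (j + 1)) x + phi (j + 1) w = 0 /\
   cs J (fib_eq (erefl (j + 1))) (psi j x) - dif J (fib_eq1 (erefl (j + 1))) y
    + h (j + 1) w = 0 by exact: (conj (congr1 fst hw) (congr1 snd hw)).
have [x1 [w1 [ex ew]]] : exists (x1 : K (j - 1)) (w1 : W j),
    x = dif K (subrK 1 j) x1 + phi j w1 /\ w = - dif W (erefl (j + 1)) w1.
  have [ltjn|] := boolP (j < n); first exact: cz.
  rewrite -leNgt => lenj; have ejn : j = n by lia.
  subst j; apply: detect.
  (* Evaluating the equation [hy] at the unit of [A] turns it into pi x + theta w = 0, which is what
     [detect] asks for. *)
  have eb : 0 = n - (n + 1 - 1) by lia.
  have : cs J (fib_eq (erefl (n + 1))) (psi n x) (cs A eb (dg_one A))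
      - (-1) ^ (n + 1 - 1) *: y (dif A (coind_eqd n (fib_eq1 (erefl (n + 1))))
          (cs A eb (dg_one A)))
      + theta (dg_act (h_eq (n + 1)) w (cs A eb (dg_one A))) = 0.
    have hy1 := congr1 (fun g : J (n + 1 - 1) =>
      (g : coind_obj A U n (n + 1 - 1)) (cs A eb (dg_one A))) hy.
    by move: hy1; rewrite /=.
  have eb' : n - (n + 1 - 1) = n - n by lia.
  have enn : n + (n - (n + 1 - 1)) = n by lia.
  rewrite (cs_coind _ eb') coind_mapE (act_csr _ _ enn) act_unit.
  by rewrite dif_unit coind0 scaler0 subr0 act_unit.
(* Once a coboundary and the image of [w1] are subtracted, only a cocycle [y1] of J in degree j - 1
   < n remains, and J is acyclic there. *)
pose z : dg_fib psi j := (x, y).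
have zc : cocycle (z - dif (dg_fib psi) (subrK 1 j) (x1, 0)
                     - fib_lift h_dif h_act j w1).
  rewrite /cocycle 2!(linearB (dif (dg_fib psi) _)) dif_dif subr0 -dgh_dif.
  by rewrite -[dif W _ w1]opprK -ew linearN opprK.
pose y1 : J (j - 1) := y - cs J (fib_eq (subrK 1 j)) (psi _ x1) - h j w1.
have ez : z - dif (dg_fib psi) (subrK 1 j) (x1, 0) - fib_lift h_dif h_act j w1
    = (0, y1).
  rewrite /y1 /z fib_difE /= linear0 subr0 ex.
  have -> : 0 = dif K (subrK 1 j) x1 + phi j w1 - dif K (subrK 1 j) x1 - phi j w1.
    by rewrite addrAC addrK subrr.
  by [].
have dy1 : dif J (fib_eq1 (erefl (j + 1))) y1 = 0.
  move: zc; rewrite ez /cocycle fib_difE => /(congr1 snd) /= /eqP.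
  by rewrite !linear0 add0r oppr_eq0 => /eqP.
have cy1 : cocycle y1 by apply/(cocycleP (fib_eq1 (erefl (j + 1)))).
have /(coind_acyclic A_conn)/(_ _ cy1) : j - 1 < n by lia.
move=> /(coboundaryP (fib_eq1 (subrK 1 j))) [y2 ey].
exists (x1, - y2), w1; split=> //.
have -> : dif (dg_fib psi) (subrK 1 j) (x1, - y2)
    = dif (dg_fib psi) (subrK 1 j) (x1, 0) + (0, y1).
  rewrite !fib_difE /= linear0 subr0 (linearN (dif J _)) opprK -ey.
  transitivity (dif K (subrK 1 j) x1 + 0,
    cs J (fib_eq (subrK 1 j)) (psi _ x1) + y1); last by [].
  by rewrite addr0.
by rewrite -ez -addrA subrK addrC subrK.
Qed.

End KillingStep.

(** Dependent choice in a family of types, by recursion on elements packed with the invariant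
    [P]. *)
Lemma dependent_choice_nat (T : nat -> Type) (P : forall m, T m -> Prop)
    (R : forall m, T m -> T m.+1 -> Prop) (x0 : T 0%N) :
  P 0%N x0 -> (forall m x, P m x -> exists y, P m.+1 y /\ R m x y) ->
  exists s : forall m, T m,
    [/\ s 0%N = x0, forall m, P m (s m) & forall m, R m (s m) (s m.+1)].
Proof.
move=> P0 step.
pose next m (x : {x : T m | P m x}) : {y : T m.+1 | P m.+1 y} :=
  let c := cid (step m (sval x) (svalP x)) in exist _ (sval c) (proj1 (svalP c)).
pose s := fix s m : {x : T m | P m x} :=
  if m is m'.+1 then next m' (s m') else exist _ x0 P0.
exists (fun m => sval (s m)); split=> // m; first exact: (svalP (s m)).
exact: (proj2 (svalP (cid (step m (sval (s m)) (svalP (s m)))))).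
Qed.

(** * Inverse limits of towers of dg modules *)

Section Limit.
Variables (k : fieldType) (A : dgAlgebra k) (K : nat -> dgModule A).
Variable p : forall m, dgHom (K m.+1) (K m).

Definition lim_prop i (x : forall m, K m i) : Prop :=
  forall m, p m i (x m.+1) = x m.

Fact lim_closed i : fam_closed (V := fun m => K m i) (@lim_prop i).
Proof.
split=> [m|a f g hf hg m]; first by rewrite linear0.
by rewrite linearP hf hg.
Qed.

Definition lim_obj i : lmodType k := subprod_of (lim_closed i).

Fact lim_dif_prop i j (e : i + 1 = j) (x : lim_obj i) :
  lim_prop (fun m => dif (K m) e (x m)).
Proof. by move=> m; rewrite dgh_dif (sp_prop x). Qed.

Definition lim_dif i j (e : i + 1 = j) (x : lim_obj i) : lim_obj j :=
  SubProd (lim_closed j) (lim_dif_prop e x).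

Fact lim_dif_linear i j (e : i + 1 = j) : linear (@lim_dif i j e).
Proof. by move=> c f g; apply: sp_ext => m /=; rewrite linearP. Qed.

HB.instance Definition _ i j (e : i + 1 = j) :=
  GRing.isLinear.Build k (lim_obj i) (lim_obj j) _
    (@lim_dif i j e) (@lim_dif_linear i j e).

Definition lim_cx : complex k.
Proof.
apply: (@Complex k lim_obj (fun i j e => @lim_dif i j e)).
by move=> i j l e e' x; apply: sp_ext => m /=; rewrite dif_dif.
Defined.

Fact lim_act_prop i j l (e : i + j = l) (x : lim_cx i) (a : A j) :
  lim_prop (fun m => dg_act e ((x : lim_obj i) m) a).
Proof. by move=> m; rewrite dgh_act (sp_prop x). Qed.

Definition lim_act i j l (e : i + j = l) (x : lim_cx i) (a : A j) : lim_cx l :=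
  SubProd (lim_closed l) (lim_act_prop e x a).

Definition dg_lim : dgModule A.
Proof.
apply: (@DgModule k A lim_cx lim_act).
- by move=> i j l e c x y a; apply: sp_ext => m /=; rewrite dg_act_linl.
- by move=> i j l e c x a a'; apply: sp_ext => m /=; rewrite dg_act_linr.
- by move=> i j l ij jl n e1 e2 e3 e4 x a a'; apply: sp_ext => m /=;
    rewrite (dg_actA e1 e2 e3 e4).
- by move=> i e x; apply: sp_ext => m /=; rewrite dg_act1.
- move=> i j l i' j' l' e ei ej el e1 e2 x a; apply: sp_ext => m /=.
  exact: dg_act_leibniz.
Defined.

Fact lim_proj_linear m i : linear (fun x : lim_obj i => x m).
Proof. by []. Qed.

Definition lim_proj_fun m i (x : dg_lim i) : K m i := (x : lim_obj i) m.

HB.instance Definition _ m i := GRing.isLinear.Build k (dg_lim i) (K m i) _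
  (@lim_proj_fun m i) (@lim_proj_linear m i).

Definition lim_proj m : dgHom dg_lim (K m).
Proof. by apply: (@DgHom k A dg_lim (K m) (fun i => @lim_proj_fun m i)). Defined.

Lemma lim_ext i (x y : dg_lim i) :
  (forall m, lim_proj m i x = lim_proj m i y) -> x = y.
Proof. exact: sp_ext. Qed.

Lemma lim_compat i (x : dg_lim i) m :
  p m i (lim_proj m.+1 i x) = lim_proj m i x.
Proof. exact: (sp_prop (x : lim_obj i)). Qed.

Lemma lim_elt i (x : forall m, K m i) : lim_prop x ->
  exists y : dg_lim i, forall m, lim_proj m i y = x m.
Proof. by move=> hx; exists (SubProd (lim_closed i) hx). Qed.

Section Lift.
Variables (W : dgModule A) (phi : forall m, dgHom W (K m)).
Hypothesis phi_compat : forall m i w, p m i (phi m.+1 i w) = phi m i w.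

Definition lim_lift_fun i (w : W i) : dg_lim i :=
  SubProd (lim_closed i) (fun m => phi_compat m w).

Fact lim_lift_linear i : linear (@lim_lift_fun i).
Proof. by move=> c x y; apply: sp_ext => m /=; rewrite linearP. Qed.

HB.instance Definition _ i := GRing.isLinear.Build k (W i) (dg_lim i) _
  (@lim_lift_fun i) (@lim_lift_linear i).

Definition lim_lift : dgHom W dg_lim.
Proof.
apply: (@DgHom k A W dg_lim (fun i => @lim_lift_fun i)).
- by move=> i j e x; apply: sp_ext => m /=; rewrite dgh_dif.
- by move=> i j n e x a; apply: sp_ext => m /=; rewrite dgh_act.
Defined.

Lemma lim_liftE m i w : lim_proj m i (lim_lift i w) = phi m i w.
Proof. by []. Qed.

End Lift.
End Limit.

(* The Milnor sequence, when the tower has no lim^1 from stage m0 on. *)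
Lemma milnor (k : fieldType) (A : dgAlgebra k) (m0 : nat) (K : nat -> dgModule A)
    (p : forall m, dgHom (K m.+1) (K m)) (i : int) (x : forall m, K m i) :
  (forall m j y, exists y', p m j y' = y) ->
  (forall m, (m0 <= m)%N -> qsurj (p m) (i - 1)) ->
  (forall m, (m0 <= m)%N -> qinj (p m) i) ->
  lim_prop p x -> (forall m, cocycle (x m)) -> coboundary (x m0) ->
  exists2 y : forall m, K m (i - 1),
    lim_prop p y & forall m, x m = dif (K m) (subrK 1 i) (y m).
Proof.
elim: m0 K p x => [|m0 IH] K p x surj qs qi cx zx bx; last first.
  have [|m|m|m|m||y cy ey] := IH (fun m => K m.+1) (fun m => p m.+1)
    (fun m => x m.+1).
  - by move=> m; apply: surj.
  - by move=> hm; apply: qs.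
  - by move=> hm; apply: qi.
  - exact: cx.
  - exact: zx.
  - exact: bx.
  (* The induction hypothesis concerns the tower without its stage 0, where the primitive is the
     image of the one at stage 1. *)
  exists (fun m => if m is m'.+1 then y m' else p 0%N _ (y 0%N)); case=> //=.
  by rewrite -dgh_dif -ey cx.
have /(coboundaryP (subrK 1 i)) [y0 ey0] := bx.
have [||y [_ ey cy]] := @dependent_choice_nat (fun m => K m (i - 1))
  (fun m y => x m = dif (K m) (subrK 1 i) y) (fun m y y' => p m _ y' = y) y0.
- by [].
- move=> m y ey.
  have bxS : coboundary (p m i (x m.+1)).
    by rewrite cx ey; apply: coboundary_dif.
  have /(coboundaryP (subrK 1 i)) [u eu] := qi m isT _ (zx m.+1) bxS.
  (* The primitive [u] need not lie over [y]. The difference is a cocycle; it lifts up to a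
     coboundary by [qs], and the coboundary lifts because the transition maps are surjective on
     elements. *)
  have cz : cocycle (p m _ u - y).
    by apply/(cocycleP (subrK 1 i)); rewrite linearB /= -dgh_dif -eu cx ey subrr.
  have [c cc /(coboundaryP (subrK 1 (i - 1))) [v ev]] := qs m isT _ cz.
  have [v' ev'] := surj m _ v.
  exists (u - c - dif (K m.+1) (subrK 1 (i - 1)) v'); split.
    rewrite 2!(linearB (dif (K m.+1) (subrK 1 i))) dif_dif subr0 -eu.
    by move/(cocycleP (subrK 1 i)): cc => ->; rewrite subr0.
  rewrite 2!(linearB (p m _)) dgh_dif ev' -ev.
  by rewrite opprB addrA subrK opprB addrC subrK.
by exists y.
Qed.

Section Factorization.
Variables (k : fieldType) (A : dgAlgebra k) (A_conn : dg_connective A).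

(** [killing_step] is iterated in degrees i, i + 1, and so on. In each degree the transition maps
    are eventually bijective on cohomology, so passing to the limit meets no lim^1. *)
Lemma factor_map (W V : dgModule A) (phi : dgHom W V) (i : int) :
  exists (V' : dgModule A) (a : dgHom W V') (b : dgHom V' V),
  [/\ forall j w, b j (a j w) = phi j w,
      forall j, j <= i -> qinj b j,
      forall j, j < i -> qsurj b j
    & forall j, i <= j -> cone_zero a j].
Proof.
pose stage := {K : dgModule A & dgHom W K}.
(* After m steps the cone is acyclic in the m degrees from i to i + m - 1. *)
pose P m (s : stage) := forall j, i <= j -> j < i + m%:Z -> cone_zero (projT2 s) j.
pose R m (s s' : stage) := exists p : dgHom (projT1 s') (projT1 s),
  [/\ forall j w, p j (projT2 s' j w) = projT2 s j w,
      forall j x, exists x', p j x' = x,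
      forall j, j <= i + m%:Z -> qinj p j
    & forall j, j < i + m%:Z -> qsurj p j].
have [||s [s0 sP sR]] := @dependent_choice_nat (fun=> stage) P R (existT _ V phi).
- by move=> j h1 h2; lia.
- move=> m [K f] fP.
  have [K' [p [f' [h1 h2 h3 h4 h5]]]] := killing_step A_conn f (i + m%:Z).
  exists (existT _ K' f'); split; last by exists p.
  by move=> j ij ltj; apply: h5 => [|ltj']; [lia|apply: fP].
pose K m := projT1 (s m).
pose f m : dgHom W (K m) := projT2 (s m).
have [p pP] : exists p : forall m, dgHom (K m.+1) (K m), forall m,
  [/\ forall j w, p m j (f m.+1 j w) = f m j w,
      forall j x, exists x', p m j x' = x,
      forall j, j <= i + m%:Z -> qinj (p m) j
    & forall j, j < i + m%:Z -> qsurj (p m) j].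
  by exists (fun m => sval (cid (sR m))) => m; case: (cid (sR m)).
have surj m : forall j y, exists y', p m j y' = y by have [] := pP m.
have fcompat m j w : p m j (f m.+1 j w) = f m j w by have [] := pP m.
have pinj m j : j <= i + m%:Z -> qinj (p m) j by have [_ _ h _] := pP m; apply: h.
have psurj m j : j < i + m%:Z -> qsurj (p m) j by have [_ _ _ h] := pP m; apply: h.
suff : exists (V' : dgModule A) (a : dgHom W V') (b : dgHom V' (projT1 (s 0%N))),
  [/\ forall j w, b j (a j w) = projT2 (s 0%N) j w,
      forall j, j <= i -> qinj b j,
      forall j, j < i -> qsurj b j
    & forall j, i <= j -> cone_zero a j] by rewrite s0.
exists (dg_lim p), (lim_lift fcompat), (lim_proj p 0%N); split.
- by [].
- move=> j leji x cx bx.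
  have [|||||y cy ey] := @milnor _ _ 0 _ p j (fun m => lim_proj p m j x) surj.
  + by move=> m _; apply: psurj; lia.
  + by move=> m _; apply: pinj; lia.
  + exact: lim_compat.
  + by move=> m; apply: dgh_cocycle.
  + exact: bx.
  have [z ez] := lim_elt cy.
  apply/(coboundaryP (subrK 1 j)); exists z; apply: lim_ext => m.
  by rewrite dgh_dif ez; apply: ey.
- move=> j ltji y cy.
  (* A cocycle [y] of stage 0 is lifted to cocycles that are compatible on the nose, not merely up
     to coboundaries. *)
  have [||x [x0 cx xcompat]] := @dependent_choice_nat (fun m => K m j)
    (fun m x => cocycle x) (fun m x x' => p m j x' = x) y.
  + by [].
  + move=> m x cx.
    have [|c cc /(coboundaryP (subrK 1 j)) [v ev]] := psurj m j _ x cx; first by lia.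
    have [v' ev'] := surj m _ v.
    exists (c + dif (K m.+1) (subrK 1 j) v'); split.
      by apply: cocycleD => //; apply: cocycle_dif.
    by rewrite linearD /= dgh_dif ev' -ev addrC subrK.
  have [z ez] := lim_elt xcompat.
  exists z; last by rewrite ez x0 subrr; apply: coboundary0.
  by apply: lim_ext => m; rewrite dgh_dif ez linear0; apply: cx.
- move=> j leij x w hxw cw.
  (* From this stage on, the cone is acyclic in degree j and the transition maps are surjective on
     H^(j-1) and injective on H^j. A solution [w1] found at stage [m0] then works in the limit. *)
  pose m0 := `|j - i|.+1.
  have fz : cone_zero (f m0) j by apply: sP => //; rewrite /m0; lia.
  have [|x1 [w1 [ex1 ew1]]] := fz (lim_proj p m0 j x) w _ cw.
    have := congr1 (lim_proj p m0 _) hxw.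
    by rewrite linearD dgh_dif lim_liftE linear0.
  pose u := x - lim_lift fcompat j w1.
  have cu : cocycle u.
    rewrite /cocycle /u linearB -dgh_dif.
    by rewrite -[dif W _ w1]opprK -ew1 linearN opprK.
  have [m hm|m hm||m||y cy ey] :=
    @milnor _ _ m0 _ p j (fun m => lim_proj p m j u) surj.
  + by apply: psurj; move: hm; rewrite /m0; lia.
  + by apply: pinj; move: hm; rewrite /m0; lia.
  + exact: lim_compat.
  + exact: dgh_cocycle.
  + rewrite /u linearB lim_liftE ex1 addrK; exact: coboundary_dif.
  have [z ez] := lim_elt cy.
  exists z, w1; split=> //; apply/eqP; rewrite -subr_eq; apply/eqP.
  by apply: lim_ext => m; rewrite ey dgh_dif ez.
Qed.

End Factorization.

(** * Factorizations in the derived category *)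

Section DerivedFactorization.
Variables (k : fieldType) (A : dgAlgebra k).
Implicit Types M N W V X Y Z : dgModule A.

Lemma Hinj_map M N (f : dgHom M N) i : Hinj (Dmap f) i <-> qinj f i.
Proof.
split=> h x; first by move=> cx bfx; apply: h (Hact_cocycle_map _ _).
move=> y cx by_ /= hxy; apply: h => //.
by rewrite -[f i x](subKr y); apply: coboundaryB.
Qed.

Lemma Hsurj_map M N (f : dgHom M N) i : Hsurj (Dmap f) i <-> qsurj f i.
Proof. by []. Qed.

Lemma coh_zero_Hinj M N (f : Dhom M N) i : coh_zero M i -> Hinj f i.
Proof. by move=> h x y cx _ _; apply: h. Qed.

Lemma Hinj_coh_zero M N (f : Dhom M N) i :
  Hinj f i -> coh_zero N i -> coh_zero M i.
Proof.
move=> h zN x cx; have [y cy hy] := Hact_total f cx.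
by apply: (h x y) => //; apply: zN.
Qed.

Lemma Hsurj_coh_zero M N (f : Dhom M N) i :
  Hsurj f i -> coh_zero M i -> coh_zero N i.
Proof.
move=> h zM y cy; have [x cx hx] := h y cy.
by apply/(Hact_coboundary f cy (zM x cx)).
Qed.

(** In the long exact sequence H^j of the cone sits between H^j(V) and H^(j+1)(W), whence this lemma
    and the next. *)
Lemma cone_zero_qsurj W V (a : dgHom W V) j : cone_zero a j -> qsurj a j.
Proof.
move=> h y cy; have [|x1 [w1 [-> e]]] := h y 0 _ (cocycle0 _ _).
  by rewrite cy linear0 addr0.
exists w1; last by rewrite addrK; apply: coboundary_dif.
by apply/eqP; rewrite -oppr_eq0 -e.
Qed.

Lemma cone_zero_qinj W V (a : dgHom W V) j : cone_zero a (j - 1) -> qinj a j.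
Proof.
move=> h w cw /(coboundaryP (subrK 1 j)) [y ey].
have e : j = j - 1 + 1 by rewrite subrK.
have [||x1 [w1 [_ e1]]] := h (- y) (cs W e w).
- rewrite hom_cs ey (cs_dif _ _ (erefl (j - 1 + 1))) linearN addNr.
  by [].
- have e' : j + 1 = j - 1 + 1 + 1 by rewrite subrK.
  by apply/(cocycleP (esym e')); rewrite (dif_cs _ _ (erefl (j + 1))); apply: cw.
apply/(coboundaryP (subrK 1 j)); exists (- w1).
apply: (@cs_inj _ _ _ _ e); rewrite e1 (cs_dif _ _ (erefl (j - 1 + 1))).
by rewrite linearN.
Qed.

Hypothesis A_conn : dg_connective A.

(** [factor_map] is applied to the numerator of a roof. In degree i, [a] is onto and [b] injective,
    so H^i(V') is the image of H^i(phi). *)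
Lemma factor_Dhom W V (phi : Dhom W V) (i : int) :
  exists (V' : dgModule A) (a : Dhom W V') (b : Dhom V' V),
  [/\ Deq phi (Dcomp b a), forall j, j <= i -> Hinj b j,
      forall j, j < i -> Hsurj b j, forall j, i <= j -> Hsurj a j
    & forall j, i < j -> Hinj a j].
Proof.
have [W' [s [qs [g e]]]] := Dhom_roof phi.
have [V' [a [b [ba b1 b2 a1]]]] := factor_map A_conn g i.
exists V', (Dcomp (Dmap a) (Dinv qs)), (Dmap b); split.
- apply: Deq_trans e _; apply: Deq_trans (Deq_sym (Deq_assoc _ _ _)).
  apply: Deq_compr; apply: Deq_trans (Deq_sym (Deq_map _ _)).
  by apply: Deq_ext => j x; rewrite /= ba.
- by move=> j h; apply/Hinj_map/b1.
- by move=> j h; apply/Hsurj_map/b2.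
- move=> j h; apply: Hsurj_comp; last by have [] := Diso_Hbij j (Diso_inv qs).
  exact/Hsurj_map/cone_zero_qsurj/a1.
- move=> j h; apply: Hinj_comp; last by have [] := Diso_Hbij j (Diso_inv qs).
  by apply/Hinj_map/cone_zero_qinj/a1; lia.
Qed.

Definition factors_below M N (f : Dhom M N) (n : int) : Prop :=
  exists (Q : dgModule A) (a : Dhom M Q) (b : Dhom Q N),
    Deq f (Dcomp b a) /\ forall j, n < j -> coh_zero Q j.

(** Factor [h] after [b] at degree n. The middle object has the cohomology of [Q], namely 0, above
    n, and in degree n the image of a zero map. *)
Lemma factors_below_comp M N P (h : Dhom N P) (f : Dhom M N) n :
  Hzero h n -> factors_below f n -> factors_below (Dcomp h f) (n - 1).
Proof.
move=> hz [Q [a [b [e zQ]]]].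
have [V' [a' [b' [e' b1 b2 a1 a2]]]] := factor_Dhom (Dcomp h b) n.
exists V', (Dcomp a' a), b'; split.
  apply: Deq_trans (Deq_compl _ e) _; apply: Deq_trans (Deq_assoc _ _ _) _.
  apply: Deq_trans (Deq_compr _ e') _; exact/Deq_sym/Deq_assoc.
move=> j ltj; have [ltnj|] := boolP (n < j).
  by apply: Hsurj_coh_zero (zQ _ ltnj); apply: a1; lia.
rewrite -leNgt => lejn; have ejn : j = n by lia.
subst j => x cx; have [q cq hq] := a1 n (lexx n) x cx.
have [y cy hy] := Hact_total b' cx.
apply: (b1 n (lexx n) x y cx _ hy).
have /(Deq_Hzero e')/(_ q y cq cy) : Hzero (Dcomp h b) n by apply: Hzero_compr.
by apply; exists x.
Qed.

(** Orthogonality for the t-structure: factored at degree n + 1, the map [b] passes through an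
    object acyclic above n because of [Q] and up to n because of [N]. *)
Lemma factors_below_zero M N (f : Dhom M N) n :
  factors_below f n -> (forall j, j <= n -> coh_zero N j) -> Deq f (Dzero M N).
Proof.
move=> [Q [a [b [e zQ]]]] zN.
have [V' [a' [b' [e' b1 b2 a1 a2]]]] := factor_Dhom b (n + 1).
have zV j : coh_zero V' j.
  have [ltj|lej] := boolP (n < j).
    by apply: Hsurj_coh_zero (zQ _ ltj); apply: a1; lia.
  by apply: Hinj_coh_zero (b1 j _) (zN _ _); lia.
apply: Deq_trans e _; apply: Deq_trans (Deq_compr _ e') _.
apply: Deq_trans (Deq_sym (Deq_assoc _ _ _)) _.
exact: Deq_through_acyclic.
Qed.

(** This condition, ker H^i(g) meets im H^i(u) in 0, and the next, im H^i(g) = im H^i(gu), say that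
    the composite loses no rank against [u] and [g] respectively. *)
Definition Hker_im W M N (g : Dhom M N) (u : Dhom W M) i : Prop :=
  forall (x : W i) (y : M i) (z : N i), cocycle x -> cocycle y -> coboundary z ->
  Hact u x y -> Hact g y z -> coboundary y.

Definition Him_sub W M N (g : Dhom M N) (u : Dhom W M) i : Prop :=
  forall (y : M i) (z : N i), cocycle y -> cocycle z -> Hact g y z ->
  exists2 x : W i, cocycle x & Hact (Dcomp g u) x z.

(* An approximation to the factorization of g through its image, which is
   correct in degrees < i only. *)
Definition image_below W Y (g : Dhom W Y) (i : int) : Prop :=
  exists (V : dgModule A) (a : Dhom W V) (b : Dhom V Y),
  [/\ Deq g (Dcomp b a), forall j, j < i -> Hinj b j, forall j, Hsurj a j
    & forall j, i <= j -> Hinj a j].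

Lemma image_below_id Y i : image_below (Did Y) i.
Proof.
exists Y, (Did Y), (Did Y); split.
- exact/Deq_sym/Deq_idl.
- by move=> j _; case: (Hbij_id Y j).
- by move=> j; case: (Hbij_id Y j).
- by move=> j _; case: (Hbij_id Y j).
Qed.

(** Factor [a] after [u] at degree i through V'. Below i the object V' has the cohomology of [V],
    already the image; in degree i it has the image of H^i(au), which injects into H^i(Y) by the
    kernel condition. *)
Lemma image_below_comp W' W Y (g : Dhom W Y) (u : Dhom W' W) i :
  image_below g i -> Hker_im g u i -> (forall j, j < i -> Him_sub g u j) ->
  image_below (Dcomp g u) (i + 1).
Proof.
move=> [V [a [b [e b1 a1 a2]]]] ku imu.
have [V' [a' [c [e' c1 c2 a1' a2']]]] := factor_Dhom (Dcomp a u) i.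
have egu : Deq (Dcomp g u) (Dcomp (Dcomp b c) a').
  apply: Deq_trans (Deq_compr _ e) _.
  apply: Deq_trans (Deq_sym (Deq_assoc _ _ _)) _.
  by apply: Deq_trans (Deq_compl _ e') _; apply: Deq_assoc.
exists V', a', (Dcomp b c); split=> //.
- move=> j ltj; have [ltji|] := boolP (j < i).
    by apply: Hinj_comp (b1 _ ltji) (c1 j _); lia.
  rewrite -leNgt => leij; have eij : j = i by lia.
  subst j => v y cv by_ hv.
  (* The class [v] comes from [w] in W', and its image in [Y] is that of [w] under gu. Since that is
     zero, [ku] gives u(w) = 0. *)
  have [w cw hw] := a1' i (lexx i) v cv.
  have [v1 cv1 hv1] := Hact_total c cv.
  have : Hact (Dcomp a u) w v1 by apply/(Deq_Hact e') => //; exists v.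
  move=> [w1 [cw1 huw haw]].
  have hgw : Hact (Dcomp g u) w y.
    by apply/(Deq_Hact egu) => //; [exact: coboundary_cocycle|exists v].
  have [y1 cy1 hy1] := Hact_total g cw1.
  have by1 : coboundary y1.
    have hgw1 : Hact (Dcomp g u) w y1 by exists w1.
    rewrite -[y1](subrK y); apply: coboundaryD => //.
    by apply/coboundaryC/(HactE (coboundary_cocycle by_) cy1 hgw).
  have bw1 : coboundary w1 := ku _ _ _ cw cw1 by1 huw hy1.
  apply: (c1 i (lexx i) v v1 cv _ hv1).
  exact/(Hact_coboundary a cv1 bw1).
- move=> j; have [leij|] := boolP (i <= j); first exact: a1'.
  rewrite -ltNge => ltji v' cv'.
  have [v cv hv] := Hact_total c cv'.
  have [w cw hw] := a1 j v cv.
  have [y cy hy] := Hact_total b cv.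
  have hgy : Hact g w y by apply/(Deq_Hact e) => //; exists v.
  (* The image of [x] in V' and [v'] agree in [Y], and H^j of bc is injective. *)
  have [x cx hx] := imu j ltji w y cw cy hgy.
  exists x => //.
  have [v2 cv2 hv2] := Hact_total a' cx.
  apply/(HactE cv2 cv' hv2).
  have : Hact (Dcomp (Dcomp b c) a') x y by apply/(Deq_Hact egu).
  move=> [v3 [cv3 h3 h3']].
  have b23 : coboundary (v2 - v3) by apply/(HactE cv2 cv3 hv2).
  have : Hact (Dcomp b c) v' y by exists v.
  move=> h4.
  have h34 : Hact (Dcomp b c) (v3 - v') (y - y).
    by apply: HactB h4; exact: h3'.
  apply: coboundary_trans b23 _.
  have ji : j <= i by lia.
  apply: (Hinj_comp (b1 j ltji) (c1 j ji)) h34; first exact: cocycleB.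
  by rewrite subrr; apply: coboundary0.
- by move=> j ltj; apply: a2'; lia.
Qed.

End DerivedFactorization.

Section Splitting.
Variables (k : fieldType) (A : dgAlgebra k).
Implicit Types X Y Z : dgModule A.

Lemma sum_cocycle X Y i (x : X i) (y : Y i) :
  cocycle ((x, y) : dg_sum X Y i) <-> cocycle x /\ cocycle y.
Proof.
rewrite /cocycle sum_difE; split=> [h|[-> ->]] //.
exact: conj (congr1 fst h) (congr1 snd h).
Qed.

Lemma sum_coboundary X Y i (x : X i) (y : Y i) :
  coboundary x -> coboundary y -> coboundary ((x, y) : dg_sum X Y i).
Proof.
move=> /(coboundaryP (subrK 1 i)) [x1 ->] /(coboundaryP (subrK 1 i)) [y1 ->].
exact: (@coboundary_dif _ (dg_sum X Y) _ _ (subrK 1 i) (x1, y1)).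
Qed.

Lemma fib_acyclic_qinj X Y (p : dgHom X Y) i :
  coh_zero (dg_fib p) i -> qinj p i.
Proof.
move=> zF x cx /(coboundaryP (subrK 1 i)) [y ey].
have : cocycle ((x, y) : dg_fib p i).
  rewrite /cocycle fib_difE /= ey (cs_dif _ _ (fib_eq1 (erefl (i + 1)))).
  by rewrite subrr cx.
move/zF => /(coboundaryP (subrK 1 i)) [[x1 y1]]; rewrite fib_difE.
by move/(congr1 fst) => /= ->; apply: coboundary_dif.
Qed.

(** H(p) is onto, so the fibre has cohomology ker H(p), and H(Y) is the direct sum of this kernel
    and the image of H(f). *)
Lemma split_qis Z Y Z' (f : dgHom Z Y) (p : dgHom Y Z') :
  quasi_iso (dgh_comp p f) ->
  quasi_iso (dgh_sub (dgh_comp f (dgh_fst Z (dg_fib p)))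
                     (dgh_comp (fib_proj p) (dgh_snd Z (dg_fib p)))).
Proof.
move=> qpf.
have ps i : qsurj p i.
  move=> z cz; have [_ /(_ z cz) [x [cx hx]]] := qpf i.
  by exists (f i x) => //; apply: dgh_cocycle.
move=> i; have [pfi pfs] := qpf i; split.
  move=> [z u] /sum_cocycle [cz cu]; rewrite /= /sub_fun /= => bzu.
  have cy : cocycle u.1 by apply: (dgh_cocycle (fib_proj p)).
  have bpu : coboundary (p i u.1).
    case: u cu {bzu cy} => y c; rewrite /cocycle fib_difE => /(congr1 snd) /=.
    move/eqP; rewrite subr_eq0 => /eqP h; apply/(coboundaryP (subrK 1 i)).
    exists c; apply: (@cs_inj _ _ _ _ (fib_eq (erefl (i + 1)))); rewrite h.
    by rewrite (cs_dif _ _ (fib_eq1 (erefl (i + 1)))).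
  have bz : coboundary z.
    apply: pfi => //=; rewrite -[p i _](subrK (p i u.1)); apply: coboundaryD => //.
    by rewrite -linearB; apply: dgh_coboundary.
  apply: sum_coboundary => //; apply: (fib_proj_qinj (ps (i - 1))) => //=.
  rewrite -[u.1](subKr (f i z)); apply: coboundaryB => //.
  exact: dgh_coboundary.
move=> y cy; have [z [cz bz]] := pfs _ (dgh_cocycle p cy).
pose y' := y - f i z.
have /(coboundaryP (subrK 1 i)) [c ec] : coboundary (p i y') by rewrite linearB.
pose u : dg_fib p i := (y', c).
have cu : cocycle u.
  rewrite /cocycle fib_difE /= ec (cs_dif _ _ (fib_eq1 (erefl (i + 1)))) subrr.
  by rewrite linearB cy /= -dgh_dif cz linear0 subr0.
exists (z, - u); split; first by apply/sum_cocycle; split=> //; apply: cocycleN.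
rewrite /= /sub_fun /= /y' opprK [f i z + _]addrC subrK subrr.
exact: coboundary0.
Qed.

End Splitting.

(** * Ranks on cohomology *)

(** Among the matrices with row space in [P], take one of maximal rank: adjoining a further vector
    of [P] cannot increase it. *)
Lemma subspace_row_free (k : fieldType) n (P : 'rV[k]_n -> Prop) :
  subspace P ->
  exists (r : nat) (B : 'M[k]_(r, n)),
    row_free B /\ forall v, P v <-> (v <= B)%MS.
Proof.
move=> sP.
pose good r := exists B : 'M[k]_n, (forall v, (v <= B)%MS -> P v) /\ \rank B = r.
have ex0 : exists r, `[< good r >].
  exists 0%N; apply/asboolP; exists 0; split; last exact: mxrank0.
  by move=> v /submx0null ->; case: sP.
have bound r : `[< good r >] -> (r <= n)%N.
  by move=> /asboolP [B [_ <-]]; apply: rank_leq_col.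
case: (ex_maxnP ex0 bound) => r /asboolP [B [BP rB]] rmax.
have PB v : P v -> (v <= B)%MS.
  move=> Pv; have : (\rank (B + v)%MS <= r)%N.
    apply: rmax; apply/asboolP; exists (B + v)%MS; split=> // w.
    move=> /sub_addsmxP [[a c] /= ->]; apply: subspaceD => //.
      by apply: BP; apply: submxMl.
    by rewrite [c]mx11_scalar mul_scalar_mx; apply: subspaceZ.
  rewrite -rB => le; have := (mxrank_leqif_sup (addsmxSl B v)).2.
  rewrite eqn_leq le mxrankS ?addsmxSl // => /esym.
  by rewrite addsmx_sub => /andP [].
exists (\rank B), (row_base B); split; first exact: row_base_free.
by move=> v; rewrite eq_row_base; split=> [/PB|/BP].
Qed.

Section Coordinates.
Variables (k : fieldType) (C : complex k) (i : int).

(** [c] induces an isomorphism of H^i(C) with the row vectors; its values off the cocycles are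
    arbitrary. *)
Definition coords n (c : C i -> 'rV[k]_n) : Prop :=
  [/\ forall (a : k) x y, cocycle x -> cocycle y ->
        c (a *: x + y) = a *: c x + c y,
      forall x, cocycle x -> (c x = 0 <-> coboundary x)
    & forall v, exists2 x, cocycle x & c x = v].

Lemma cocycle_sum n (r : 'I_n -> k) (z : 'I_n -> C i) :
  (forall p, cocycle (z p)) -> cocycle (\sum_p r p *: z p).
Proof.
move=> cz; apply: (big_ind (@cocycle k C i)) => [|x y|p _].
- exact: cocycle0.
- exact: cocycleD.
- exact/cocycleZ/cz.
Qed.

Lemma coordsB n (c : C i -> 'rV[k]_n) x y : coords c -> cocycle x -> cocycle y ->
  c (x - y) = c x - c y.
Proof.
by move=> [lc _ _] cx cy; rewrite addrC -scaleN1r lc // scaleN1r addrC.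
Qed.

Lemma coords_eq n (c : C i -> 'rV[k]_n) x y : coords c -> cocycle x -> cocycle y ->
  c x = c y <-> coboundary (x - y).
Proof.
move=> hc cx cy; have [_ zc _] := hc.
rewrite -zc ?coordsB //; last exact: cocycleB.
by split=> [->|/eqP]; rewrite ?subrr // subr_eq0 => /eqP.
Qed.

Lemma coords_sum n m (c : C i -> 'rV[k]_m) (r : 'I_n -> k) (z : 'I_n -> C i) :
  coords c -> (forall p, cocycle (z p)) ->
  c (\sum_p r p *: z p) = \sum_p r p *: c (z p).
Proof.
move=> [lc zc _] cz.
have c0 : c 0 = 0 by apply/zc; [exact: cocycle0|exact: coboundary0].
have : cocycle (\sum_p r p *: z p) /\
    c (\sum_p r p *: z p) = \sum_p r p *: c (z p); last by case.
apply: (big_ind2 (fun x v => cocycle x /\ c x = v)).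
- by split=> //; apply: cocycle0.
- move=> x v y w [cx <-] [cy <-]; split; first exact: cocycleD.
  by rewrite -[x in c (x + y)]scale1r lc // scale1r.
- move=> p _; split; first exact/cocycleZ/cz.
  by rewrite -[r p *: z p]addr0 lc ?c0 ?addr0 //; apply: cocycle0.
Qed.

Lemma coords_basis n (c : C i -> 'rV[k]_n) : coords c ->
  exists z : 'I_n -> C i,
    (forall p, cocycle (z p)) /\ forall p, c (z p) = delta_mx 0 p.
Proof.
move=> [_ _ sc].
have [z hz] := choice (fun p : 'I_n =>
  let: ex_intro2 x cx ex := sc (delta_mx 0 p) in
  ex_intro (fun x => cocycle x /\ c x = delta_mx 0 p) x (conj cx ex)).
by exists z; split=> p; case: (hz p).
Qed.

Lemma coh_dim_coords n :
  coh_dim C i n <-> exists c : C i -> 'rV[k]_n, coords c.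
Proof.
split=> [[z [cz hz]]|[c hc]].
  have ex x : exists r : 'rV[k]_n, cocycle x -> 
      coboundary (x - \sum_(p < n) r 0 p *: z p).
    have [cx|ncx] := pselect (cocycle x); last by exists 0.
    by have [r [hr _]] := hz x cx; exists r.
  have [c hc] := choice ex.
  have uc x (r : 'rV[k]_n) : cocycle x -> coboundary (x - \sum_(p < n) r 0 p *: z p) -> c x = r.
    move=> cx hr; have [r' [hr' uniq]] := hz x cx.
    by rewrite -(uniq r hr) -(uniq _ (hc x cx)).
  exists c; split.
  - move=> a x y cx cy; apply: uc; first by apply/cocycleD/cy/cocycleZ.
    have -> : \sum_(p < n) (a *: c x + c y) 0 p *: z p =
        a *: \sum_(p < n) c x 0 p *: z p + \sum_(p < n) c y 0 p *: z p.
      rewrite scaler_sumr -big_split /=; apply: eq_bigr => p _.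
      by rewrite !mxE scalerDl scalerA.
    rewrite opprD addrACA -scalerBr.
    by apply/coboundaryD/hc/cy/coboundaryZ/hc.
  - move=> x cx; split=> [cx0|bx].
      have := hc x cx; rewrite cx0 big1 ?subr0 // => p _.
      by rewrite mxE scale0r.
    apply: uc => //; rewrite big1 ?subr0 // => p _.
    by rewrite mxE scale0r.
  - move=> v; exists (\sum_(p < n) v 0 p *: z p); first exact: cocycle_sum.
    apply: uc; first exact: cocycle_sum.
    by rewrite subrr; apply: coboundary0.
have [z [cz ez]] := coords_basis hc.
have cs (r : 'rV[k]_n) : c (\sum_(p < n) r 0 p *: z p) = r.
  rewrite (coords_sum _ hc cz) [RHS]row_sum_delta.
  by apply: eq_bigr => p _; rewrite ez.
exists z; split=> // x cx; exists (c x); split.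
  by apply/(coords_eq hc); rewrite ?cs //; exact: cocycle_sum.
move=> r /(coords_eq hc cx) h; rewrite h ?cs //; exact: cocycle_sum.
Qed.

End Coordinates.

Section CoordinateMatrix.
Variables (k : fieldType) (A : dgAlgebra k).
Implicit Types M N : dgModule A.

(** The rows of [R] are the coordinates of the images of a basis of H^i(M). As coordinates are row
    vectors, matrices multiply in the order opposite to composition. *)
Lemma coords_matrix M N (f : Dhom M N) i m n (c : M i -> 'rV[k]_m)
    (c' : N i -> 'rV[k]_n) : coords c -> coords c' ->
  exists R : 'M[k]_(m, n), forall x y, cocycle x -> cocycle y ->
    Hact f x y <-> c' y = c x *m R.
Proof.
move=> hc hc'; have [z [cz ez]] := coords_basis hc.
have [w hw] := choice (fun p => let: ex_intro2 y cy hy := Hact_total f (cz p) in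
  ex_intro (fun y => cocycle y /\ Hact f (z p) y) y (conj cy hy)).
have cw p : cocycle (w p) by have [] := hw p.
have zw p : Hact f (z p) (w p) by have [] := hw p.
pose R := \matrix_(p, q) c' (w p) 0 q.
exists R => x y cx cy.
pose z' := \sum_(p < m) c x 0 p *: z p; pose w' := \sum_(p < m) c x 0 p *: w p.
have cz' : cocycle z' by apply: cocycle_sum.
have cw' : cocycle w' by apply: cocycle_sum.
have xz : coboundary (x - z').
  apply/(coords_eq hc) => //; rewrite (coords_sum _ hc cz) [LHS]row_sum_delta.
  by apply: eq_bigr => p _; rewrite ez.
have hzw : Hact f z' w'.
  rewrite /z' /w'; apply: (big_ind2 (@Hact _ _ _ _ f i)) => [|x1 y1 x2 y2 h1 h2|p _].
  - by apply/Hact_coboundary; [exact: cocycle0|exact: coboundary0..].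
  - by rewrite -[x1]scale1r -[y1]scale1r; apply: Hact_lin.
  - exact: HactZ.
have -> : c x *m R = c' w'.
  rewrite (coords_sum _ hc' cw); apply/rowP => q; rewrite !mxE summxE.
  by apply: eq_bigr => p _; rewrite !mxE.
have h := Hact_cohom cw' cy (coboundaryC xz) hzw.
rewrite h; split=> [b|e]; last by apply/(coords_eq hc').
by apply/(coords_eq hc') => //; apply/coboundaryC.
Qed.

(** The two matrices of the identity, from one coordinate system to the other and back, have product
    1. *)
Lemma coords_dim_unique M i m n (c : M i -> 'rV[k]_m) (c' : M i -> 'rV[k]_n) :
  coords c -> coords c' -> m = n.
Proof.
suff le m' n' (d : M i -> 'rV[k]_m') (d' : M i -> 'rV[k]_n') :
    coords d -> coords d' -> (m' <= n')%N.
  by move=> h h'; apply/eqP; rewrite eqn_leq !(le _ _ c c', le _ _ c' c).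
move=> hd hd'; have [R RP] := coords_matrix (Did M) hd hd'.
have [R' RP'] := coords_matrix (Did M) hd' hd.
apply: (@mulmx1_min _ _ _ R R'); apply/row_matrixP => p.
have [_ _ /(_ (delta_mx 0 p)) [x cx ex]] := hd.
have hx : Hact (Did M) x x by apply/Hact_id; rewrite subrr; apply: coboundary0.
rewrite rowE mulmxA -ex -(iffLR (RP x x cx cx) hx) -(iffLR (RP' x x cx cx) hx).
by rewrite ex rowE mulmx1.
Qed.

Lemma coh_dim_zero M i : coh_zero M i -> coh_dim M i 0.
Proof.
move=> z; apply/coh_dim_coords; exists (fun=> 0); split.
- by move=> a x y _ _; rewrite scaler0 addr0.
- by move=> x cx; split=> // _; apply: z.
- by move=> v; exists 0; [exact: cocycle0|apply/rowP; case].
Qed.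

(** H^i(M) is identified with a subspace of row vectors, and coordinates are taken in a basis [B] of
    it. *)
Lemma Hinj_coh_dim M N (f : Dhom M N) i n :
  Hinj f i -> coh_dim N i n -> exists r, coh_dim M i r.
Proof.
move=> fi /coh_dim_coords [c hc].
pose P v := exists x y, [/\ cocycle x, cocycle y, Hact f x y & c y = v].
have [lc zc sc] := hc.
have sP : subspace P.
  split.
    exists 0, 0; split; try exact: cocycle0.
      by apply/Hact_coboundary; [exact: cocycle0|exact: coboundary0..].
    by apply/zc; [exact: cocycle0|exact: coboundary0].
  move=> a v w [x [y [cx cy h <-]]] [x' [y' [cx' cy' h' <-]]].
  exists (a *: x + x'), (a *: y + y'); split.
  - exact/cocycleD/cx'/cocycleZ.
  - exact/cocycleD/cy'/cocycleZ.
  - exact: Hact_lin.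
  - exact: lc.
have [r [B [freeB PB]]] := subspace_row_free sP.
exists r; apply/coh_dim_coords.
have ex x : exists u : 'rV[k]_r, cocycle x ->
    exists y, [/\ cocycle y, Hact f x y & c y = u *m B].
  have [cx|ncx] := pselect (cocycle x); last by exists 0.
  have [y cy hy] := Hact_total f cx.
  have /PB /submxP [u eu] : P (c y) by exists x, y.
  by exists u => _; exists y.
have [e he] := choice ex.
exists e; split.
- move=> a x x' cx cx'.
  have [y [cy hy ey]] := he x cx; have [y' [cy' hy' ey']] := he x' cx'.
  have cz : cocycle (a *: x + x') by apply/cocycleD/cx'/cocycleZ.
  have [z [cz' hz ez]] := he _ cz.
  apply: (row_free_inj freeB); rewrite -ez mulmxDl -scalemxAl -ey -ey' -lc //.
  apply/(coords_eq hc) => //; first by apply/cocycleD/cy'/cocycleZ.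
  apply/(HactE _ _ hz) => //; first by apply/cocycleD/cy'/cocycleZ.
  exact: Hact_lin.
- move=> x cx; have [y [cy hy ey]] := he x cx; split=> [e0|bx].
    apply: (fi x y) => //; apply/zc => //; by rewrite ey e0 mul0mx.
  apply: (row_free_inj freeB); rewrite -ey mul0mx; apply/zc => //.
  exact/(Hact_coboundary f cy bx).
- move=> u; have /PB [x [y [cx cy hy ey]]] : (u *m B <= B)%MS by apply: submxMl.
  exists x => //; have [y' [cy' hy' ey']] := he x cx.
  apply: (row_free_inj freeB); rewrite -ey' -ey; apply/(coords_eq hc) => //.
  exact/(HactE cy' cy hy').
Qed.

End CoordinateMatrix.

(** * Ranks of morphisms in the extended heart *)

Section Hearts.
Variables (k : fieldType) (A : dgAlgebra k) (d : nat).
Implicit Types M N P W X Y Z : dgModule A.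

Definition in_range (i : int) : Prop := - d%:Z < i /\ i <= 0.

Lemma in_rangeP i : in_range i <-> exists e : 'I_d, i = - (e : nat)%:Z.
Proof.
rewrite /in_range; split=> [[h1 h2]|[[e he] ->] /=]; last by lia.
have he : (`|i| < d)%N by lia.
by exists (Ordinal he) => /=; lia.
Qed.

Lemma in_heartP M : in_heart d M <->
  (forall i, exists n, coh_dim M i n) /\ (forall i, ~ in_range i -> coh_zero M i).
Proof.
split=> [[[n [s [h [us zs ds _]]]] z]|[dM z]]; split=> //.
  move=> i; have [his|his] := boolP (i \in s); first by exists (h i); apply: ds.
  by exists 0%N; apply/coh_dim_zero/zs.
have [h hP] := choice dM.
exists (\sum_(i <- [seq - (e : nat)%:Z | e <- iota 0 d]) h i)%N.
exists [seq - (e : nat)%:Z | e <- iota 0 d], h; split=> //.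
- by rewrite map_inj_uniq ?iota_uniq // => e e' /oppr_inj [].
- move=> i ni; apply: z => /in_rangeP [e ei]; move/negP: ni; apply.
  by apply/mapP; exists (e : nat) => //; rewrite mem_iota /= add0n.
Qed.

Lemma heart_zero M i : in_heart d M -> ~ in_range i -> coh_zero M i.
Proof. by move=> /in_heartP [_]; apply. Qed.

Lemma heart_Hinj M N (f : Dhom M N) :
  (forall i, Hinj f i) -> in_heart d N -> in_heart d M.
Proof.
move=> fi /in_heartP [dN zN]; apply/in_heartP; split=> i.
  by have [n hn] := dN i; apply: Hinj_coh_dim (fi i) hn.
by move=> ni; apply: Hinj_coh_zero (fi i) (zN i ni).
Qed.

(** By [split_qis], [Y] is the sum of [Z] and the fibre of [p] in D(A). As [Z] is nonzero the fibre
    is acyclic, which makes H(p) injective. *)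
Lemma indecomposable_split Z Y Z' (f : Dhom Z Y) (p : Dhom Y Z') :
  in_heart d Y -> indecomposable d Y -> (forall i, Hbij (Dcomp p f) i) ->
  ~ (forall i, coh_zero Z i) -> forall i, Hbij p i.
Proof.
move=> hY [_ indY] pf nZ.
(* Replacing [Y] and [Z] by quasi-isomorphic modules turns [p] and [f] into maps of dg modules. *)
have [Y' [s [qs [p' ep]]]] := Dhom_roof p.
have [Z0 [t [qt [f' ef]]]] := Dhom_roof (Dcomp (Dinv qs) f).
have qpf : quasi_iso (dgh_comp p' f').
  apply/Hbij_quasi_iso => i.
  suff e : Deq (Dmap (dgh_comp p' f')) (Dcomp (Dcomp p f) (Dmap t)).
    have [h1 h2] := Hbij_comp (pf i) (Diso_Hbij i (Diso_qis qt)).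
    by split; [exact: (Deq_Hinj (Deq_sym e))|exact: (Deq_Hsurj (Deq_sym e))].
  apply: Deq_trans (Deq_sym (Deq_map _ _)) (Deq_sym _).
  have e1 : Deq (Dcomp p f) (Dcomp (Dcomp (Dmap p') (Dmap f')) (Dinv qt)).
    apply: Deq_trans (Deq_compr _ ep) _.
    apply: Deq_trans (Deq_sym (Deq_assoc _ _ _)) _.
    apply: Deq_trans (Deq_compl _ ef) _; exact: Deq_assoc.
  apply: Deq_trans (Deq_compr _ e1) _.
  apply: Deq_trans (Deq_sym (Deq_assoc _ _ _)) _.
  apply: Deq_trans (Deq_compl _ (Deq_invl qt)) _; exact: Deq_idr.
have qq := split_qis qpf.
have siso i := Diso_Hbij i (Diso_qis qs).
have hY' : in_heart d Y' by apply: (@heart_Hinj _ _ (Dmap s)) hY => i; case: (siso i).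
have p's i : qsurj p' i.
  move=> z cz; have [_ /(_ z cz) [x [cx hx]]] := qpf i.
  by exists (f' i x) => //; apply: dgh_cocycle.
(* Indecomposability speaks of summands in the heart; both summands lie there, since their
   cohomology embeds in that of [Y']. *)
have hZ0 : in_heart d Z0.
  apply: (@heart_Hinj _ _ (Dmap f')) hY' => i.
  apply: (@Hinj_of_comp _ _ _ _ _ (Dmap p')).
  apply: (Deq_Hinj (Deq_sym (Deq_map _ _))).
  by case: (iffRL (Hbij_quasi_iso _) qpf i).
have hF : in_heart d (dg_fib p').
  apply: (@heart_Hinj _ _ (Dmap (fib_proj p'))) hY' => i.
  exact/Hinj_map/fib_proj_qinj/p's.
have [| |] := indY _ _ hZ0 hF.
- exists (Dcomp (Dinv qq) (Dinv qs)).
  exact: Diso_comp (Diso_inv qq) (Diso_inv qs).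
- move=> /Disomorphic_zero zZ0; case: nZ => i.
  apply: (@Hsurj_coh_zero _ _ _ _ (Dmap t)) (zZ0 i).
  by case: (Diso_Hbij i (Diso_qis qt)).
move=> /Disomorphic_zero zF i; split; last first.
  by apply: (@Hsurj_of_comp _ _ _ _ _ _ f); case: (pf i).
apply: (Deq_Hinj (Deq_sym ep)); apply: Hinj_comp.
  exact/Hinj_map/fib_acyclic_qinj/zF.
by case: (Diso_Hbij i (Diso_inv qs)).
Qed.

(** Coordinates are fixed once for each object, so that matrices of composable morphisms match. The
    default covers infinite-dimensional H^i(M), excluded in the heart by [hcoP]. *)
Definition coh_coord M i : {n : nat & M i -> 'rV[k]_n} :=
  match pselect (exists s : {n : nat & M i -> 'rV[k]_n}, coords (projT2 s)) with
  | left ex => sval (cid ex)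
  | right _ => existT _ 0%N (fun=> 0)
  end.

Definition hdim M i : nat := projT1 (coh_coord M i).
Definition hco M i : M i -> 'rV[k]_(hdim M i) := projT2 (coh_coord M i).

Lemma hcoP M i : in_heart d M -> coords (@hco M i).
Proof.
move=> /in_heartP [/(_ i) [n /coh_dim_coords [c hc]] _].
rewrite /hco /hdim /coh_coord; case: pselect => [ex|[]]; last first.
  by exists (existT _ n c).
exact: (svalP (cid ex)).
Qed.

Definition Hmx M N (f : Dhom M N) i : 'M[k]_(hdim M i, hdim N i) :=
  match pselect (exists R : 'M[k]_(hdim M i, hdim N i),
    forall x y, cocycle x -> cocycle y -> Hact f x y <-> hco y = hco x *m R) with
  | left ex => sval (cid ex)
  | right _ => 0
  end.

Lemma HmxP M N (f : Dhom M N) i x y : in_heart d M -> in_heart d N ->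
  cocycle x -> cocycle y -> Hact f x y <-> @hco N i y = hco x *m Hmx f i.
Proof.
move=> hM hN cx cy; rewrite /Hmx; case: pselect => [ex|[]].
  exact: (svalP (cid ex)).
exact: coords_matrix (hcoP i hM) (hcoP i hN).
Qed.

Lemma Hmx_uniq M N (f : Dhom M N) i (R : 'M[k]_(hdim M i, hdim N i)) :
  in_heart d M -> in_heart d N ->
  (forall x y, cocycle x -> cocycle y -> Hact f x y -> hco y = hco x *m R) ->
  Hmx f i = R.
Proof.
move=> hM hN h; apply/row_matrixP => p.
have [_ _ sc] := hcoP i hM; have [x cx ex] := sc (delta_mx 0 p).
have [y cy hy] := Hact_total f cx.
by rewrite !rowE -ex -(h x y) // -(iffLR (HmxP f hM hN cx cy)).
Qed.

Lemma Hmx_comp M N P (g : Dhom N P) (f : Dhom M N) i :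
  in_heart d M -> in_heart d N -> in_heart d P ->
  Hmx (Dcomp g f) i = Hmx f i *m Hmx g i.
Proof.
move=> hM hN hP; apply: Hmx_uniq => // x z cx cz [y [cy hf hg]].
by rewrite mulmxA -(iffLR (HmxP f hM hN cx cy)) // -(iffLR (HmxP g hN hP cy cz)).
Qed.

Lemma Deq_Hmx M N (f g : Dhom M N) i : in_heart d M -> in_heart d N ->
  Deq f g -> Hmx f i = Hmx g i.
Proof.
move=> hM hN fg; apply: Hmx_uniq => // x y cx cy h.
by apply/(HmxP g hM hN cx cy); apply/(Deq_Hact fg).
Qed.

Definition Hrank M N (f : Dhom M N) : nat :=
  (\sum_(e < d) \rank (Hmx f (- (e : nat)%:Z)))%N.

Lemma sum_leq_eq (F G : 'I_d -> nat) : (forall e, F e <= G e)%N ->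
  (\sum_(e < d) G e <= \sum_(e < d) F e)%N -> forall e, F e = G e.
Proof.
move=> FG le e.
have := (leqif_sum (P := predT) (fun e _ => leqif_eq (FG e))).2.
by rewrite eqn_leq le leq_sum // => /esym /forallP /(_ e) /eqP.
Qed.

Lemma Deq_Hrank M N (f g : Dhom M N) : in_heart d M -> in_heart d N ->
  Deq f g -> Hrank f = Hrank g.
Proof. by move=> hM hN fg; apply: eq_bigr => e _; rewrite (Deq_Hmx _ hM hN fg). Qed.

Lemma Hrank_compl M N P (g : Dhom N P) (f : Dhom M N) :
  in_heart d M -> in_heart d N -> in_heart d P ->
  (Hrank (Dcomp g f) <= Hrank f)%N.
Proof.
by move=> hM hN hP; apply: leq_sum => e _; rewrite Hmx_comp //; apply: mxrankM_maxl.
Qed.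

Lemma Hrank_compr M N P (g : Dhom N P) (f : Dhom M N) :
  in_heart d M -> in_heart d N -> in_heart d P ->
  (Hrank (Dcomp g f) <= Hrank g)%N.
Proof.
by move=> hM hN hP; apply: leq_sum => e _; rewrite Hmx_comp //; apply: mxrankM_maxr.
Qed.

(** In each degree composition can only lower the rank, so equal sums force equal ranks degree by
    degree. *)
Lemma Hrank_ker_im M N P (g : Dhom N P) (f : Dhom M N) :
  in_heart d M -> in_heart d N -> in_heart d P ->
  (Hrank f <= Hrank (Dcomp g f))%N -> forall i, Hker_im g f i.
Proof.
move=> hM hN hP le i; have [|ni] := pselect (in_range i); last first.
  by move=> x y z cx cy bz hf hg; apply: heart_zero hN ni _ cy.
move=> /in_rangeP [e ->] x y z cx cy bz hf hg.
have eq : \rank (Hmx f (- (e : nat)%:Z) *m Hmx g (- (e : nat)%:Z))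
    = \rank (Hmx f (- (e : nat)%:Z)).
  rewrite -Hmx_comp //; apply: (sum_leq_eq _ le) => e'.
  by rewrite Hmx_comp //; apply: mxrankM_maxl.
move: eq; set F := Hmx f _; set G := Hmx g _ => eq.
(* Rank-nullity on the row space of F: rank F = rank FG + rank of the intersection with ker G. *)
have cap0 : (F :&: kermx G)%MS = 0.
  apply/eqP; rewrite -mxrank_eq0 -(eqn_add2l (\rank (F *m G))) mxrank_mul_ker.
  by rewrite addn0 eq.
have [_ zc _] := hcoP (- (e : nat)%:Z) hN; apply/zc => //.
have [_ zc' _] := hcoP (- (e : nat)%:Z) hP.
have e1 := iffLR (HmxP f hM hN cx cy) hf.
have e2 := iffLR (HmxP g hN hP cy (coboundary_cocycle bz)) hg.
apply/eqP; rewrite -submx0 -cap0 sub_capmx e1 submxMl /=.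
rewrite -e1; apply/sub_kermxP; rewrite -e2; apply/zc' => //.
exact: coboundary_cocycle.
Qed.

(** Dually, the image of gf lies in that of g and has the same dimension. *)
Lemma Hrank_im_sub M N P (g : Dhom N P) (f : Dhom M N) :
  in_heart d M -> in_heart d N -> in_heart d P ->
  (Hrank g <= Hrank (Dcomp g f))%N -> forall i, Him_sub g f i.
Proof.
move=> hM hN hP le i; have [|ni] := pselect (in_range i); last first.
  move=> y z cy cz hg; exists 0; first exact: cocycle0.
  apply/Hact_coboundary => //; first exact: coboundary0.
  exact: heart_zero hP ni _ cz.
move=> /in_rangeP [e ->] y z cy cz hg.
have eq : \rank (Hmx f (- (e : nat)%:Z) *m Hmx g (- (e : nat)%:Z))
    = \rank (Hmx g (- (e : nat)%:Z)).
  rewrite -Hmx_comp //; apply: (sum_leq_eq _ le) => e'.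
  by rewrite Hmx_comp //; apply: mxrankM_maxr.
move: eq; set F := Hmx f _; set G := Hmx g _ => eq.
have GFG : (G <= F *m G)%MS.
  have := (mxrank_leqif_sup (submxMl F G)).2; rewrite eq eqxx.
  by move/esym.
have /submxP [w ew] : (hco y *m G <= F *m G)%MS.
  exact: submx_trans (submxMl _ _) GFG.
have [_ _ sc] := hcoP (- (e : nat)%:Z) hM; have [x cx ex] := sc w.
exists x => //; apply/(HmxP (Dcomp g f) hM hP cx cz).
by rewrite Hmx_comp // ex -ew; apply/(HmxP g hN hP cy cz).
Qed.

Lemma Hrank0_Hzero M N (f : Dhom M N) : in_heart d M -> in_heart d N ->
  Hrank f = 0%N -> forall i, Hzero f i.
Proof.
move=> hM hN r0 i x y cx cy hf.
have [|ni] := pselect (in_range i); last exact: heart_zero hN ni _ cy.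
move=> /in_rangeP [e ei]; subst i.
have [_ zc _] := hcoP (- (e : nat)%:Z) hN; apply/zc => //.
rewrite (iffLR (HmxP f hM hN cx cy) hf).
suff -> : Hmx f (- (e : nat)%:Z) = 0 by rewrite mulmx0.
apply/eqP; rewrite -mxrank_eq0 -leqn0 -r0 /Hrank (bigD1 e) //=.
exact: leq_addr.
Qed.

Lemma coh_dim_le_sum M b : in_heart d M -> coh_dim_le M b ->
  (\sum_(e < d) hdim M (- (e : nat)%:Z) <= b)%N.
Proof.
move=> hM [n [[s [h [us zs ds ->]]] le]]; apply: leq_trans le.
have dim_h i : i \in s -> hdim M i = h i.
  move=> /ds /coh_dim_coords [c hc]; exact: coords_dim_unique (hcoP i hM) hc.
have dim0 i : i \notin s -> hdim M i = 0%N.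
  move=> /zs /coh_dim_zero /coh_dim_coords [c hc].
  exact: coords_dim_unique (hcoP i hM) hc.
rewrite -(big_mkord xpredT (fun e => hdim M (- e%:Z))) /index_iota subn0.
rewrite -(big_map (fun e : nat => - e%:Z) xpredT (hdim M)).
set r := map _ _.
have ur : uniq r by rewrite map_inj_uniq ?iota_uniq // => e e' /oppr_inj [].
(* The list [s] need not be the range of the heart. Degrees outside [s] contribute 0, and those in
   both lists form part of the sum over [s]. *)
rewrite (bigID (mem s)) /= [X in (_ + X)%N]big1 ?addn0; last by move=> i /dim0.
rewrite (eq_bigr h); last by move=> i /dim_h.
rewrite -big_filter (perm_big (filter (mem r) s)); last first.
  apply: uniq_perm; rewrite ?filter_uniq // => i.
  by rewrite !mem_filter andbC.
rewrite big_filter [X in (_ <= X)%N](bigID (mem r)) /=; exact: leq_addr.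
Qed.

(** The rank is at least both total dimensions, so the matrix is square and invertible in every
    degree. *)
Lemma Hrank_full M N (f : Dhom M N) b : in_heart d M -> in_heart d N ->
  coh_dim_le M b -> coh_dim_le N b -> (b <= Hrank f)%N -> is_Diso f.
Proof.
move=> hM hN bM bN le; apply: Hbij_Diso => i.
have [|ni] := pselect (in_range i); last first.
  split; first by apply: coh_zero_Hinj; apply: heart_zero ni.
  move=> y cy; exists 0; first exact: cocycle0.
  by apply/Hact_coboundary => //; [exact: coboundary0|exact: heart_zero ni _ cy].
move=> /in_rangeP [e ->].
have rM : \rank (Hmx f (- (e : nat)%:Z)) = hdim M (- (e : nat)%:Z).
  apply: (sum_leq_eq (F := fun e : 'I_d => \rank (Hmx f (- (e : nat)%:Z)))
    (G := fun e : 'I_d => hdim M (- (e : nat)%:Z))) => [e'|].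
    exact: rank_leq_row.
  exact: leq_trans (coh_dim_le_sum hM bM) le.
have rN : \rank (Hmx f (- (e : nat)%:Z)) = hdim N (- (e : nat)%:Z).
  apply: (sum_leq_eq (F := fun e : 'I_d => \rank (Hmx f (- (e : nat)%:Z)))
    (G := fun e : 'I_d => hdim N (- (e : nat)%:Z))) => [e'|].
    exact: rank_leq_col.
  exact: leq_trans (coh_dim_le_sum hN bN) le.
move: (- (e : nat)%:Z) rM rN => j rM rN.
have [_ zM sM] := hcoP j hM; have [_ zN _] := hcoP j hN.
split=> [x y cx by_ hf|y cy].
  have cy := coboundary_cocycle by_.
  have free : row_free (Hmx f j) by rewrite /row_free rM.
  apply/zM => //; apply: (row_free_inj free); rewrite mul0mx.
  by rewrite -(iffLR (HmxP f hM hN cx cy) hf); apply/zN.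
have full : row_full (Hmx f j) by rewrite /row_full rN.
have /submxP [w ew] := submx_full (hco y) full.
have [x cx ex] := sM w; exists x => //.
by apply/(HmxP f hM hN cx cy); rewrite ew ex.
Qed.

End Hearts.

(** * Chains of non-isomorphisms *)

Section Chains.
Variables (k : fieldType) (A : dgAlgebra k) (d b : nat).
Hypothesis A_conn : dg_connective A.
Implicit Types M N P W X Y Z : dgModule A.

Definition admissible M : Prop :=
  [/\ in_heart d M, indecomposable d M & coh_dim_le M b].

(* f is, up to isomorphism, a composite of n non-isomorphisms between
   admissible objects. *)
Fixpoint chain n M N (f : Dhom M N) : Prop :=
  if n is m.+1 then
    exists (P : dgModule A) (g : Dhom M P) (h : Dhom P N),
      [/\ chain m g, admissible N, ~ is_Diso h & Deq f (Dcomp h g)]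
  else [/\ admissible M, admissible N & is_Diso f].

Lemma chain_source n M N (f : Dhom M N) : chain n f -> admissible M.
Proof. by elim: n M N f => [|n IH] M N f /= => [[]|[P [g [h [/IH]]]]]. Qed.

Lemma chain_target n M N (f : Dhom M N) : chain n f -> admissible N.
Proof. by case: n => [|n] /= => [[]|[P [g [h []]]]]. Qed.

Lemma admissible_heart M : admissible M -> in_heart d M.
Proof. by case. Qed.

Lemma chain_split m n M N (f : Dhom M N) : chain (m + n) f ->
  exists (P : dgModule A) (g : Dhom M P) (h : Dhom P N),
    [/\ chain n g, chain m h & Deq f (Dcomp h g)].
Proof.
elim: m N f => [|m IH] N f.
  move=> cf; exists N, f, (Did N); split=> //; last exact/Deq_sym/Deq_idl.
  have aN := chain_target cf; split=> //.
  by exists (Did N); split; apply: Deq_idl.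
rewrite addSn => -[P [g [h [/IH [Q [u [v [cu cv e]]]] aN nh e']]]].
exists Q, u, (Dcomp h v); split=> //; first by exists P, v, h; split=> //; apply: Deq_refl.
apply: Deq_trans e' _; apply: Deq_trans (Deq_compl _ e) _; exact: Deq_assoc.
Qed.

Definition rank_bound n r : Prop :=
  forall M N (f : Dhom M N), chain n f -> (Hrank d f <= r)%N.

Lemma rank_boundD n m r : rank_bound n r -> rank_bound (m + n) r.
Proof.
move=> h M N f /chain_split [P [g [u [cg cu e]]]].
have hM := admissible_heart (chain_source cg).
have hP := admissible_heart (chain_target cg).
have hN := admissible_heart (chain_target cu).
rewrite (Deq_Hrank hM hN e); apply: leq_trans (h _ _ _ cg).
exact: Hrank_compl.
Qed.

(** By [Hrank_full], rank b would make the non-isomorphism invertible. *)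
Lemma rank_bound1 b' : b = b'.+1 -> rank_bound 1 b'.
Proof.
move=> eb M N f [P [g [h [[aM aP gi] aN nh e]]]].
have [hM _ _] := aM; have [hP _ bP] := aP; have [hN _ bN] := aN.
rewrite (Deq_Hrank hM hN e) leqNgt; apply/negP => lt; apply: nh.
apply: (Hrank_full hP hN bP bN); rewrite eb; apply: leq_trans lt _.
exact: Hrank_compr.
Qed.

Lemma Deq_image_below W Y (f g : Dhom W Y) i :
  Deq f g -> image_below f i -> image_below g i.
Proof.
move=> fg [V [a [c [e h1 h2 h3]]]]; exists V, a, c; split=> //.
exact: Deq_trans (Deq_sym fg) e.
Qed.

(** There are q + 1 blocks and q connecting morphisms. No part has rank above [r] and the whole has
    rank at least [r], so no rank is lost and [image_below_comp] applies. Each block raises the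
    degree by one, starting from 1 - d. *)
Lemma blocks_image_below n r q M N (f : Dhom M N) :
  rank_bound n r -> chain (n + q * n.+1) f -> (r <= Hrank d f)%N ->
  image_below f (1 - d%:Z + q.+1%:Z).
Proof.
move=> rb; elim: q M N f => [|q IH] M N f.
  rewrite mul0n addn0 => cf _.
  have aN := admissible_heart (chain_target cf).
  apply: Deq_image_below (Deq_idl f) _.
  (* A single block is composed with the identity of [N]; below degree 1 - d the cohomology of [N]
     vanishes. *)
  apply: (image_below_comp A_conn (image_below_id N _)).
    move=> x y z cx cy bz hf /Hact_id byz; rewrite -[y](subrK z).
    exact: coboundaryD.
  move=> j ltj y z cy cz hy; exists 0; first exact: cocycle0.
  apply/Hact_coboundary => //; first exact: coboundary0.
  by apply: (heart_zero aN) cz => -[]; lia.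
have -> : (n + q.+1 * n.+1 = n + q * n.+1 + n.+1)%N by lia.
move=> /chain_split [P [u [g [cu cg e]]]] le.
have hM := admissible_heart (chain_source cu).
have hP := admissible_heart (chain_target cu).
have hN := admissible_heart (chain_target cg).
rewrite (Deq_Hrank hM hN e) in le.
apply: Deq_image_below (Deq_sym e) _.
have -> : 1 - d%:Z + q.+2%:Z = 1 - d%:Z + q.+1%:Z + 1 by lia.
have leu : (Hrank d u <= r)%N by apply: (@rank_boundD n 1).
have leg : (Hrank d g <= r)%N.
  by move: cg; rewrite addnC; apply: rank_boundD.
apply: (image_below_comp A_conn).
- by apply: IH => //; apply: leq_trans le _; apply: Hrank_compr.
- by apply: (Hrank_ker_im hM hP hN); apply: leq_trans leu le.
- by move=> j _; apply: (Hrank_im_sub hM hP hN); apply: leq_trans leg le.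
Qed.

(** In degrees >= 1 the cohomology of [V] is a quotient of that of [W], hence zero, so the
    approximate image is the full image. *)
Lemma image_below_heart W Y (f : Dhom W Y) :
  in_heart d W -> image_below f 1 ->
  exists (V : dgModule A) (a : Dhom W V) (c : Dhom V Y),
    [/\ Deq f (Dcomp c a), forall j, Hinj c j & forall j, Hsurj a j].
Proof.
move=> hW [V [a [c [e h1 h2 h3]]]]; exists V, a, c; split=> // j.
have [ltj|lej] := boolP (j < 1); first exact: h1.
apply: coh_zero_Hinj; apply: Hsurj_coh_zero (h2 j) _.
by apply: (heart_zero hW) => -[]; lia.
Qed.

Lemma Hrank_acyclic M N Z (a : Dhom M Z) (c : Dhom Z N) :
  in_heart d M -> in_heart d N -> (forall i, coh_zero Z i) ->
  Hrank d (Dcomp c a) = 0%N.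
Proof.
move=> hM hN zZ; rewrite /Hrank big1 // => e _.
suff -> : Hmx (Dcomp c a) (- (e : nat)%:Z) = 0 by rewrite mxrank0.
apply: (Hmx_uniq hM hN) => x y cx cy [z [cz _ hz]]; rewrite mulmx0.
have [_ zN _] := hcoP (- (e : nat)%:Z) hN; apply/zN => //.
exact/(Hact_coboundary c cy (zZ _ z cz)).
Qed.

(* The images Z of gL and Z' of gR are isomorphic through h, hence are direct
   summands of Y1 and of X2. *)
Lemma connecting_iso X1 Y1 X2 Y2 (gL : Dhom X1 Y1) (h : Dhom Y1 X2)
    (gR : Dhom X2 Y2) :
  admissible X1 -> admissible Y1 -> admissible X2 -> admissible Y2 ->
  image_below gL 1 -> image_below gR 1 ->
  (0 < Hrank d (Dcomp gR (Dcomp h gL)))%N ->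
  (Hrank d gL <= Hrank d (Dcomp gR (Dcomp h gL)))%N ->
  (Hrank d gR <= Hrank d (Dcomp gR (Dcomp h gL)))%N -> is_Diso h.
Proof.
move=> [hX1 _ _] [hY1 iY1 _] [hX2 iX2 _] [hY2 _ _] imL imR r0 rL rR.
have [Z [a [c [eL ci ai]]]] := image_below_heart hX1 imL.
have [Z' [a' [c' [eR ci' ai']]]] := image_below_heart hX2 imR.
have ker i : Hker_im (Dcomp gR h) gL i.
  apply: (Hrank_ker_im hX1 hY1 hY2); apply: leq_trans rL _.
  by rewrite (Deq_Hrank hX1 hY2 (Deq_assoc _ _ _)).
have im i : Him_sub gR (Dcomp h gL) i by apply: (Hrank_im_sub hX1 hX2 hY2).
have Zn : ~ (forall i, coh_zero Z i).
  move=> zZ; move: r0; rewrite ltnNge => /negP; apply.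
  rewrite (Deq_Hrank hX1 hY2 (Deq_assoc _ _ _)).
  apply: leq_trans (Hrank_compl _ _ hX1 hY1 hY2) _.
  by rewrite (Deq_Hrank hX1 hY1 eL) Hrank_acyclic.
(* Injectivity: no rank is lost after [gL], so gR h is injective on its image. Surjectivity: the
   whole composite has the same image as [gR]. *)
have kbij i : Hbij (Dcomp (Dcomp a' h) c) i.
  split=> [z z' cz bz' [y [cy hc [x2 [cx2 hh ha']]]]|z' cz'].
    have cz' := coboundary_cocycle bz'.
    have [x cx hx] := ai i z cz.
    have [w cw hw] := Hact_total c' cz'.
    have bw : coboundary w by apply/(Hact_coboundary c' cw bz').
    apply: (ci i z y cz _ hc).
    apply: (ker i x y w cx cy bw).
      by apply/(Deq_Hact eL) => //; exists z.
    exists x2; split=> //; apply/(Deq_Hact eR) => //; by exists z'.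
  have [x2 cx2 hx2] := ai' i z' cz'.
  have [w cw hw] := Hact_total c' cz'.
  have gw : Hact gR x2 w by apply/(Deq_Hact eR) => //; exists z'.
  have [x cx [x2' [cx2' [y [cy hL hh]] hR]]] := im i x2 w cx2 cw gw.
  have [z [cz haz hcz]] := iffLR (Deq_Hact eL cx cy) hL.
  have [z2 [cz2 haz2 hcz2]] := iffLR (Deq_Hact eR cx2' cw) hR.
  exists z => //.
  have kz : Hact (Dcomp (Dcomp a' h) c) z z2.
    by exists y; split=> //; exists x2'.
  apply/(HactE cz2 cz' kz); apply: (ci' i _ (w - w)).
  - exact: cocycleB.
  - by rewrite subrr; apply: coboundary0.
  - exact: HactB.
(* Indecomposability of [Y1] makes a'h bijective on cohomology, and that of [X2] makes [a']
   bijective; cancelling [a'] leaves [h]. *)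
have pbij := indecomposable_split hY1 iY1 kbij Zn.
have kbij' i : Hbij (Dcomp a' (Dcomp h c)) i.
  have [k1 k2] := kbij i; have e := Deq_sym (Deq_assoc a' h c).
  by split; [exact: (Deq_Hinj e)|exact: (Deq_Hsurj e)].
have a'bij := indecomposable_split hX2 iX2 kbij' Zn.
apply: Hbij_Diso => i; have [p1 p2] := pbij i; split; first exact: Hinj_of_comp p1.
by apply: Hsurj_cancel p2 _; case: (a'bij i).
Qed.

(* 2d blocks of n non-isomorphisms, with a non-isomorphism between consecutive
   blocks. *)
Lemma rank_boundS n r : (1 <= d)%N -> rank_bound n r.+1 ->
  rank_bound (2 * d * n.+1).-1 r.
Proof.
move=> d1 rb M N f.
(* The length of d blocks with their d - 1 connecting morphisms; two such halves and the middle
   morphism have length 2L + 1 = 2d(n + 1) - 1. *)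
pose L := (n + d.-1 * n.+1)%N.
have -> : ((2 * d * n.+1).-1 = L + L.+1)%N.
  rewrite /L; case: d d1 => // d' _ /=; lia.
move=> /chain_split [X2 [u [gR [[Y1 [gL [h [cL aX2 nh eu]]]] cR e]]]].
rewrite leqNgt; apply/negP => lt; apply: nh.
have aM := chain_source cL; have aY1 := chain_target cL.
have aN := chain_target cR.
have eg : Deq f (Dcomp gR (Dcomp h gL)).
  by apply: Deq_trans e _; apply: Deq_compl.
have [hM hN] := (admissible_heart aM, admissible_heart aN).
have [hY1 hX2] := (admissible_heart aY1, admissible_heart aX2).
rewrite (Deq_Hrank hM hN eg) in lt.
have rbL : rank_bound L r.+1 by rewrite /L addnC; apply: rank_boundD.
have leL : (r.+1 <= Hrank d gL)%N.
  apply: leq_trans lt _; rewrite (Deq_Hrank hM hN (Deq_assoc _ _ _)).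
  exact: Hrank_compl.
have leR : (r.+1 <= Hrank d gR)%N.
  by apply: leq_trans lt _; apply: Hrank_compr.
have e1 : 1 - d%:Z + d.-1.+1%:Z = 1 by lia.
apply: (connecting_iso aM aY1 aX2 aN (gL := gL) (gR := gR)).
- by rewrite -e1; apply: blocks_image_below rb cL leL.
- by rewrite -e1; apply: blocks_image_below rb cR leR.
- exact: leq_trans lt.
- exact: leq_trans (rbL _ _ _ cL) lt.
- exact: leq_trans (rbL _ _ _ cR) lt.
Qed.

(** Counted in objects, one more than in morphisms, the length starts at 2 and is multiplied by 2d
    whenever the rank drops by one. *)
Lemma rank_bound_iter b' j : (1 <= d)%N -> b = b'.+1 -> (j <= b')%N ->
  rank_bound (2 * (2 * d) ^ j).-1 (b' - j).
Proof.
move=> d1 eb; elim: j => [|j IH] lej.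
  by rewrite expn0 muln1 subn0; apply: rank_bound1.
have -> : (2 * (2 * d) ^ j.+1 = 2 * d * (2 * (2 * d) ^ j).-1.+1)%N.
  rewrite prednK; first by rewrite expnS; lia.
  by rewrite muln_gt0 expn_gt0 muln_gt0 d1.
apply: rank_boundS => //.
by rewrite -subSn // subSS; apply: IH; apply: ltnW.
Qed.

(** Each block of [n] non-isomorphisms is zero on cohomology and lowers the degree by one, starting
    from 0 for the source. *)
Lemma chain_factors_below n e M N (f : Dhom M N) :
  rank_bound n 0 -> chain (e * n) f -> factors_below f (- e%:Z).
Proof.
move=> rb; elim: e N f => [|e IH] N f.
  move=> cf; exists M, (Did M), f; split; first exact/Deq_sym/Deq_idr.
  move=> j ltj; apply: (heart_zero (admissible_heart (chain_source cf))).
  by case; lia.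
rewrite mulSn => /chain_split [P [g [h [cg ch eg]]]].
have hP := admissible_heart (chain_target cg).
have hN := admissible_heart (chain_target ch).
have hz i : Hzero h i.
  by apply: (Hrank0_Hzero hP hN); apply/eqP; rewrite -leqn0; apply: rb ch.
have -> : - e.+1%:Z = - e%:Z - 1 by lia.
have [Q [u [v [e1 zQ]]]] := factors_below_comp A_conn (hz _) (IH _ _ cg).
by exists Q, u, v; split=> //; apply: Deq_trans eg e1.
Qed.

(** After [d] blocks the composite factors through an object living in degrees <= -d, where the
    target has no cohomology. *)
Lemma chain_zero n M N (f : Dhom M N) :
  rank_bound n 0 -> chain (d * n) f -> Deq f (Dzero M N).
Proof.
move=> rb cf; apply: (factors_below_zero A_conn (chain_factors_below rb cf)).
move=> j lej; apply: (heart_zero (admissible_heart (chain_target cf))).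
by case; lia.
Qed.

(** For b = 0 the zero endomorphism has full rank, so it is invertible and [M] is zero. *)
Lemma admissible_b_gt0 M : admissible M -> (0 < b)%N.
Proof.
move=> [hM [nz _] bM]; rewrite lt0n; apply/eqP => b0; apply: nz.
rewrite b0 in bM; have zi : is_Diso (Dzero M M) by apply: (Hrank_full hM hM bM bM).
apply/Disomorphic_zero => i x cx; have [zinj _] := Diso_Hbij i zi.
apply: (zinj x 0 cx); first exact: coboundary0.
by rewrite /= subrr; apply: coboundary0.
Qed.

End Chains.

(** With B = b + 1, the left side is d < d + 1 if B = 1. If B >= 2 it is less than (2d)^B, and 2d =
    2(d - 1) + 2 <= B(d - 1) + 2. *)
Lemma chain_length_bound (d b : nat) : (1 <= d)%N ->
  (d * (2 * (2 * d) ^ b).-1 < (b.+1 * (d - 1) + 2) ^ b.+1)%N.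
Proof.
move=> d1; case: b => [|b].
  by rewrite expn0 expn1; lia.
have le : ((2 * d) ^ b.+2 <= (b.+2 * (d - 1) + 2) ^ b.+2)%N.
  by rewrite leq_exp2r //; nia.
apply: leq_trans le; rewrite [X in (_ <= X)%N]expnS.
have : (0 < (2 * d) ^ b.+1)%N by rewrite expn_gt0 muln_gt0 d1.
by move: ((2 * d) ^ b.+1)%N => x x0; nia.
Qed.

(* M_i and f_i, numbered from 1, are [M i.-1] and [f i.-1]; the values of [M] at
   indices >= t, and of [f] at indices >= t - 1, are irrelevant. *)
Theorem corollary3p14 (k : fieldType) (A : dgAlgebra k) (d b t : nat)
  (A_proper : dg_proper A) (A_connective : dg_connective A)
  (d_ge1 : (1 <= d)%N) (A_heart : in_heart d (dg_regular A))
  (M : nat -> dgModule A) (f : forall i : nat, Dhom (M i) (M i.+1))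
  (M_heart : forall i : nat, (i < t)%N -> in_heart d (M i))
  (M_indec : forall i : nat, (i < t)%N -> indecomposable d (M i))
  (M_dim : forall i : nat, (i < t)%N -> coh_dim_le (M i) b)
  (f_noniso : forall i : nat, (i.+1 < t)%N -> ~ is_Diso (f i))
  (t_large : ((b * (d - 1) + 2) ^ b <= t)%N) :
  Deq (Dcomp_seq f t.-1) (Dzero (M 0%N) (M t.-1)).
Proof.
have adm i : (i < t)%N -> admissible d b (M i).
  by move=> lti; split; [exact: M_heart|exact: M_indec|exact: M_dim].
have t_gt0 : (0 < t)%N by apply: leq_trans t_large; rewrite expn_gt0 addn2.
have chain_f n : (n < t)%N -> chain d b n (Dcomp_seq f n).
  elim: n => [|n IH] ltn.
    split; [exact: adm|exact: adm|].
    by exists (Did (M 0%N)); split; apply: Deq_idl.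
  exists (M n), (Dcomp_seq f n), (f n); split.
  - by apply: IH; apply: ltnW.
  - exact: adm.
  - exact: f_noniso.
  - exact: Deq_refl.
have b_gt0 := admissible_b_gt0 (adm 0%N t_gt0).
case: b b_gt0 t_large adm chain_f {M_dim} => // b' _ t_large adm chain_f.
have := @rank_bound_iter k A d b'.+1 A_connective b' b' d_ge1 erefl (leqnn _).
rewrite subnn; set n := (_.-1) => rb.
have len := chain_length_bound b' d_ge1.
have lt1 : (t.-1 < t)%N by rewrite prednK.
have := chain_f t.-1 lt1.
(* The first d * n of the t - 1 morphisms already compose to zero. *)
have -> : chain d b'.+1 t.-1 (Dcomp_seq f t.-1)
    = chain d b'.+1 (t.-1 - d * n + d * n) (Dcomp_seq f t.-1).
  by rewrite subnK // -ltnS prednK //; apply: leq_trans len t_large.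
move=> /chain_split [P [g [h [cg ch e]]]].
apply: Deq_trans e _.
apply: Deq_trans (Deq_compl _ (chain_zero A_connective rb cg)) _.
exact: Deq_comp0.
Qed.
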